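(* Let $(R,\mathfrak m)$ be a Cohen-Macaulay local ring of dimension $d\ge1$ with infinite residue field. Let $I_1,I_2$ be $\mathfrak m$-primary ideals and let $(x_1,\dots,x_d)$ be a minimal reduction of $I_2$ generated by a superficial sequence $x_1,\dots,x_d$ for $I_2$ and $I_1$. Write $J=(x_1,\dots,x_d)$. Let $0\le i\le d-1$, and put $K_i=R$ if $0\le i\le d-2$ and $K_{d-1}=I_1$. Then $$f_{i}=\sum_{n\ge i}\binom ni\left[\ell\!\left(\frac{I_2^n}{I_1I_2^n+J\cap I_2^n}\right)-\sum_{j\ge1}(-1)^j\bigl[h_j(0,n)-h_j(1,n)\bigr]\right]-(-1)^d\ell\!\left(\frac R{K_i}\right)$$ and $$f_{i}=\sum_{n\ge i}\binom ni\left[\ell\!\left(\frac{I_2^n}{I_1I_2^n}\right)-\ell\!\left(\frac{JI_2^{n-1}}{JI_1I_2^{n-1}}\right)-\sum_{j\ge2}(-1)^j\bigl[h_j(0,n)-h_j(1,n)\bigr]\right]-(-1)^d\ell\!\left(\frac R{K_i}\right).$$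
   Context: $\ell$ denotes length. Convention: $I^n=R$ for $n\le0$. The integers $f_i=f_{i,I_1}(I_2)$, $0\le i\le d-1$, are the Hilbert coefficients of the fiber cone $F_{I_1}(I_2)=\bigoplus_{n\ge0}I_2^n/I_1I_2^n$, defined by $$\ell(I_2^n/I_1I_2^n)=\sum_{i=0}^{d-1}(-1)^if_i\binom{n+d-1-i}{d-1-i}\quad\text{for }n\gg0.$$ For $n\in\mathbb Z$, let $C(0,n)$ (resp. $C(1,n)$) be the complex whose degree $j$ term ($0\le j\le d$) is $(R/I_2^{n-j})^{\binom dj}$ (resp. $(R/I_1I_2^{n-j})^{\binom dj}$) and whose differentials are induced by those of the Koszul complex $K_\bullet(x_1,\dots,x_d;R)$. Put $h_j(0,n):=\ell(H_j(C(0,n)))$ and $h_j(1,n):=\ell(H_j(C(1,n)))$. An element $x\in I_2$ is superficial for $I_2$ and $I_1$ if there is a positive integer $r_0$ such that $xR\cap I_1^sI_2^r=xI_1^sI_2^{r-1}$ for all $r\ge r_0$ and all $s\ge0$. A sequence $x_1,\dots,x_d$ in $I_2$ is a superficial sequence for $I_2$ and $I_1$ if for each $i$ the image of $x_i$ in $R/(x_1,\dots,x_{i-1})$ is superficial for the images of $I_2$ and $I_1$. *)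

(* Defs.v *)
From HB Require Import structures.
From mathcomp Require Import all_boot all_order all_algebra.
From mathcomp Require Import boolp classical_sets functions cardinality fsbigop.

Set Implicit Arguments.
Unset Strict Implicit.
Unset Printing Implicit Defensive.

Import Order.TTheory GRing.Theory Num.Theory.

Local Open Scope classical_set_scope.
Local Open Scope quotient_scope.
Local Open Scope ring_scope.

Reserved Notation "x \inS N" (at level 70, no associativity).

Section Submodules.
Variables (R : comPzRingType) (V : lmodType R).

Definition is_submodule (N : set V) : Prop :=
  N 0 /\ forall (a : R) (u v : V), N u -> N v -> N (a *: u + v).

Record submod := Submod {
  submod_set :> set V;
  submodP : is_submodule submod_set }.

Local Notation "x \inS N" := (submod_set N x).

Section Closure.
Variable N : submod.

Lemma submod0 : 0 \inS N. Proof. exact: (submodP N).1. Qed.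

Lemma submodZD a u v : u \inS N -> v \inS N -> a *: u + v \inS N.
Proof. exact: (submodP N).2. Qed.

Lemma submodD u v : u \inS N -> v \inS N -> u + v \inS N.
Proof. by move=> Nu Nv; rewrite -[u]scale1r; apply: submodZD. Qed.

Lemma submodZ a u : u \inS N -> a *: u \inS N.
Proof. by move=> Nu; rewrite -[_ *: _]addr0; apply: submodZD => //; exact: submod0. Qed.

Lemma submodN u : u \inS N -> - u \inS N.
Proof. by move=> Nu; rewrite -scaleN1r; apply: submodZ. Qed.

Lemma submodB u v : u \inS N -> v \inS N -> u - v \inS N.
Proof. by move=> Nu Nv; apply: submodD => //; apply: submodN. Qed.

End Closure.

Lemma full_is_submodule : is_submodule setT.
Proof. by []. Qed.

Definition fullS : submod := Submod full_is_submodule.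

Lemma span_is_submodule (A : set V) : is_submodule (smallest is_submodule A).
Proof.
split=> [N [[N0 _] _] //|a u v Au Av N NA].
by case: (NA) => -[_ NZD] _; apply: NZD; [apply: Au|apply: Av].
Qed.

Definition span (A : set V) : submod := Submod (span_is_submodule A).

Definition addS (M N : submod) : submod := span (M `|` N).

Lemma cap_is_submodule (M N : submod) : is_submodule (M `&` N).
Proof.
split=> [|a u v [Mu Nu] [Mv Nv]]; first by split; exact: submod0.
by split; apply: submodZD.
Qed.

Definition capS (M N : submod) : submod := Submod (cap_is_submodule M N).

Definition submod_pred (M : submod) : {pred V} := fun x => `[< x \inS M >].

Fact submod_pred_closed (M : submod) : GRing.submod_closed (submod_pred M).
Proof.
split=> [|a u v]; first by apply/asboolP; exact: submod0.
by move=> /asboolP Mu /asboolP Mv; apply/asboolP; apply: submodZD.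
Qed.

HB.instance Definition _ (M : submod) :=
  GRing.isSubmodClosed.Build R V (submod_pred M) (submod_pred_closed M).

Definition submod_type (M : submod) := {x : V | x \in submod_pred M}.

HB.instance Definition _ (M : submod) := SubChoice.on (submod_type M).
HB.instance Definition _ (M : submod) :=
  [SubChoice_isSubLmodule of submod_type M by <:].

Section Quotient.
Variable N : submod.

Definition quot_rel : rel V := fun u v => `[< u - v \inS N >].

Fact quot_rel_refl : reflexive quot_rel.
Proof. by move=> u; apply/asboolP; rewrite subrr; exact: submod0. Qed.

Fact quot_rel_sym : symmetric quot_rel.
Proof.
by move=> u v; apply/asboolP/asboolP => /submodN; rewrite opprB.
Qed.

Fact quot_rel_trans : transitive quot_rel.
Proof.
move=> v u w /asboolP Nuv /asboolP Nvw; apply/asboolP.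
by rewrite -(subrKA v); apply: submodD.
Qed.

Canonical quot_equiv : equiv_rel V :=
  EquivRel quot_rel quot_rel_refl quot_rel_sym quot_rel_trans.

Definition quot := {eq_quot quot_equiv}.

HB.instance Definition _ := Choice.on quot.
HB.instance Definition _ := EqQuotient.on quot.

Definition quot_pi (u : V) : quot := \pi_quot u.

Lemma quot_piP u v : quot_pi u = quot_pi v <-> u - v \inS N.
Proof.
split=> [/eqmodP /asboolP //|Nuv]; by apply/eqmodP/asboolP.
Qed.

Lemma quot_piK (x : quot) : quot_pi (repr x) = x.
Proof. exact: reprK. Qed.

Lemma repr_quot_pi u : repr (quot_pi u) - u \inS N.
Proof. by apply/quot_piP; rewrite quot_piK. Qed.

Definition quot_add (x y : quot) : quot := quot_pi (repr x + repr y).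
Definition quot_opp (x : quot) : quot := quot_pi (- repr x).
Definition quot_scale (a : R) (x : quot) : quot := quot_pi (a *: repr x).

Fact quot_addE u v : quot_add (quot_pi u) (quot_pi v) = quot_pi (u + v).
Proof.
apply/quot_piP; rewrite opprD addrACA.
by apply: submodD; exact: repr_quot_pi.
Qed.

Fact quot_oppE u : quot_opp (quot_pi u) = quot_pi (- u).
Proof.
by apply/quot_piP; rewrite -opprD; apply: submodN; exact: repr_quot_pi.
Qed.

Fact quot_scaleE a u : quot_scale a (quot_pi u) = quot_pi (a *: u).
Proof.
by apply/quot_piP; rewrite -scalerBr; apply: submodZ; exact: repr_quot_pi.
Qed.

Fact quot_addA : associative quot_add.
Proof.
move=> x y z; rewrite -(quot_piK x) -(quot_piK y) -(quot_piK z).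
move: (repr x) (repr y) (repr z) => u v w.
by rewrite (quot_addE v w) (quot_addE u v) !quot_addE addrA.
Qed.

Fact quot_addC : commutative quot_add.
Proof. by move=> x y; rewrite /quot_add addrC. Qed.

Fact quot_add0 : left_id (quot_pi 0) quot_add.
Proof. by move=> x; rewrite -[x]quot_piK quot_addE add0r. Qed.

Fact quot_addN : left_inverse (quot_pi 0) quot_opp quot_add.
Proof. by move=> x; rewrite -[x]quot_piK quot_oppE quot_addE addNr. Qed.

HB.instance Definition _ :=
  GRing.isZmodule.Build quot quot_addA quot_addC quot_add0 quot_addN.

Fact quot_scaleA a b x : quot_scale a (quot_scale b x) = quot_scale (a * b) x.
Proof. by rewrite -(quot_piK x) (quot_scaleE b) !quot_scaleE scalerA. Qed.

Fact quot_scale1 : left_id 1 quot_scale.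
Proof. by move=> x; rewrite -[x]quot_piK quot_scaleE scale1r. Qed.

Fact quot_scaleDr : right_distributive quot_scale +%R.
Proof.
move=> a x y; rewrite -(quot_piK x) -(quot_piK y).
move: (repr x) (repr y) => u v.
rewrite [quot_pi u + quot_pi v]quot_addE !quot_scaleE scalerDr.
by rewrite [RHS]quot_addE.
Qed.

Fact quot_scaleDl x : {morph quot_scale^~ x : a b / a + b}.
Proof.
move=> a b; rewrite -[x]quot_piK !quot_scaleE.
by rewrite [RHS]quot_addE scalerDl.
Qed.

HB.instance Definition _ := GRing.Zmodule_isLmodule.Build R quot
  quot_scaleA quot_scale1 quot_scaleDr quot_scaleDl.

Fact quot_pi_linear : linear quot_pi.
Proof.
move=> a u v; rewrite -quot_addE -quot_scaleE; by [].
Qed.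

HB.instance Definition _ :=
  GRing.isLinear.Build R V quot *:%R quot_pi quot_pi_linear.

End Quotient.

End Submodules.

Notation "x \inS N" := (submod_set N x) : ring_scope.

Arguments fullS {R V}.
Arguments is_submodule {R V} N.

Section LinearMaps.
Variables (R : comPzRingType) (U V : lmodType R) (f : {linear U -> V}).

Lemma comap_is_submodule (N : submod V) : is_submodule (f @^-1` N).
Proof.
split=> [|a u v Nu Nv]; rewrite /preimage /= ?linear0 ?linearP.
  exact: submod0.
exact: submodZD.
Qed.

Definition comapS (N : submod V) : submod U := Submod (comap_is_submodule N).

Lemma ker_is_submodule : is_submodule [set u | f u = 0].
Proof.
split=> [|a u v /= fu fv] /=; first exact: linear0.
by rewrite linearP fu fv scaler0 addr0.
Qed.

Definition kerS : submod U := Submod ker_is_submodule.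

Lemma im_is_submodule : is_submodule (range f).
Proof.
split=> [|a ? ? [u _ <-] [v _ <-]]; first by exists 0; rewrite ?linear0.
by exists (a *: u + v) => //; rewrite linearP.
Qed.

Definition imS : submod V := Submod im_is_submodule.

(* The map U/M -> V/N induced by f, which exists when f maps M into N; the
   value 0 otherwise makes the definition total. *)
Definition quot_map_fun (M : submod U) (N : submod V) (x : quot M) : quot N :=
  if pselect (f @` M `<=` N) then quot_pi N (f (repr x)) else 0.

Lemma quot_map_funE (M : submod U) (N : submod V) u :
  f @` M `<=` N -> quot_map_fun N (quot_pi M u) = quot_pi N (f u).
Proof.
rewrite /quot_map_fun; case: pselect => // MN _; apply/quot_piP.
rewrite -linearB; apply: MN; exists (repr (quot_pi M u) - u) => //.
exact: repr_quot_pi.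
Qed.

Fact quot_map_linear (M : submod U) (N : submod V) :
  linear (@quot_map_fun M N).
Proof.
have [MN|MN] := pselect (f @` M `<=` N); last first.
  have E (x : quot M) : quot_map_fun N x = 0 by rewrite /quot_map_fun; case: pselect.
  by move=> a x y; rewrite !E scaler0 addr0.
move=> a x y; rewrite -(quot_piK x) -(quot_piK y) -linearP !quot_map_funE //.
by rewrite !linearP.
Qed.

End LinearMaps.

Section QuotMap.
Variables (R : comPzRingType) (U V : lmodType R) (f : {linear U -> V}).
Variables (M : submod U) (N : submod V).

HB.instance Definition _ :=
  GRing.isLinear.Build R (quot M) (quot N) *:%R (@quot_map_fun R U V f M N)
    (@quot_map_linear R U V f M N).

Definition quot_map : {linear quot M -> quot N} :=
  @quot_map_fun R U V f M N.

End QuotMap.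

(* The quotient M/N, used for N contained in M (in general M/(M `&` N)). *)
Definition subquot (R : comPzRingType) (V : lmodType R) (M N : submod V) :
    lmodType R :=
  quot (comapS (val : {linear submod_type M -> V}) N).

Definition is_maximum (P : nat -> Prop) (n : nat) : Prop :=
  P n /\ forall k, P k -> (k <= n)%N.

Definition submod_chain (R : comPzRingType) (V : lmodType R) (n : nat) : Prop :=
  exists p : nat -> submod V, forall k, (k < n)%N -> p k `<` p k.+1.

(* The value is 0 on modules of infinite length. *)
Definition length (R : comPzRingType) (V : lmodType R) : nat :=
  xget 0%N (is_maximum (@submod_chain R V)).

Notation ideal R := (submod R^o).

Section Ideals.
Variable R : comPzRingType.
Implicit Types I J : ideal R.

Definition ideal_span (A : set R) : ideal R := @span R R^o A.

Definition ideal_gen (k : nat) (x : 'I_k -> R) : ideal R :=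
  ideal_span (range x).

Definition idealM I J : ideal R :=
  ideal_span [set z | exists a b : R, [/\ a \inS I, b \inS J & z = a * b]].

Definition idealX I (n : nat) : ideal R := iter n (idealM I) fullS.

(* The convention I^n = R for n <= 0. *)
Definition idealXz I (n : int) : ideal R :=
  if n is Posz k then idealX I k else fullS.

Definition prime_ideal I : Prop :=
  ~ 1 \inS I /\ forall a b : R, a * b \inS I -> a \inS I \/ b \inS I.

Definition maximal_ideal I : Prop :=
  ~ 1 \inS I /\
  forall J, ~ 1 \inS J -> I `<=` J -> J = I :> set R.

Definition radical I : set R := [set a | exists n, a ^+ n \inS I].

Definition primary_ideal I : Prop :=
  ~ 1 \inS I /\ forall a b : R, a * b \inS I -> a \inS I \/ radical I b.

Definition m_primary (m I : ideal R) : Prop :=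
  primary_ideal I /\ radical I = m.

Definition noetherian : Prop :=
  forall I, exists (k : nat) (g : 'I_k -> R), I = ideal_gen g :> set R.

Definition local_ring (m : ideal R) : Prop :=
  maximal_ideal m /\ forall I, maximal_ideal I -> I = m :> set R.

Definition prime_chain (n : nat) : Prop :=
  exists p : nat -> ideal R,
    (forall k, (k <= n)%N -> prime_ideal (p k)) /\
    (forall k, (k < n)%N -> p k `<` p k.+1).

Definition krull_dim (n : nat) : Prop := is_maximum prime_chain n.

Definition prefix_ideal (k : nat) (x : 'I_k -> R) (i : 'I_k) : ideal R :=
  ideal_span [set x j | j in [set j : 'I_k | (j < i)%N]].

Definition regular_seq (k : nat) (y : 'I_k -> R) : Prop :=
  ~ 1 \inS ideal_gen y /\
  forall (i : 'I_k) (z : quot (prefix_ideal y i)), y i *: z = 0 -> z = 0.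

Definition depth (m : ideal R) (n : nat) : Prop :=
  is_maximum (fun k => exists y : 'I_k -> R,
                (forall i, y i \inS m) /\ regular_seq y) n.

Definition reduction J I : Prop :=
  J `<=` I /\ exists n, idealM J (idealX I n) = idealX I n.+1 :> set R.

Definition minimal_reduction J I : Prop :=
  reduction J I /\
  forall J', reduction J' I -> J' `<=` J -> J' = J :> set R.

Definition superficial (I2 I1 : ideal R) (x : R) : Prop :=
  x \inS I2 /\
  exists2 r0 : nat, (0 < r0)%N & forall r s : nat, (r0 <= r)%N ->
    (range ( *%R x)) `&` idealM (idealX I1 s) (idealX I2 r) =
    [set x * a | a in idealM (idealX I1 s) (idealX I2 r.-1) : set R].

End Ideals.

Definition cohen_macaulay_local (R : comNzRingType) (m : ideal R) : Prop :=
  [/\ noetherian R, local_ring m & exists2 k, krull_dim R k & depth m k].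

Section QuotientRing.
Variables (R : comPzRingType) (I : ideal R).

Definition quot_ring := quot I.

HB.instance Definition _ := GRing.Zmodule.on quot_ring.

Definition quot_ring_mul (x y : quot_ring) : quot_ring :=
  quot_pi I (repr x * repr y).

Definition quot_ring_pi (a : R) : quot_ring := quot_pi I a.

Fact quot_ring_mulE a b :
  quot_ring_mul (quot_ring_pi a) (quot_ring_pi b) = quot_ring_pi (a * b).
Proof.
apply/quot_piP; set a' := repr _; set b' := repr _.
have -> : a' * b' - a * b = b' *: (a' - a : R^o) + a *: (b' - b : R^o).
  by rewrite /GRing.scale /= !mulrBr addrA [b' * a']mulrC [b' * a]mulrC subrK.
by apply: submodZD; [|apply: submodZ]; exact: repr_quot_pi.
Qed.

Fact quot_ring_piK x : quot_ring_pi (repr (x : quot I)) = x.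
Proof. exact: quot_piK. Qed.

Fact quot_ring_mulA : associative quot_ring_mul.
Proof.
move=> x y z; rewrite -(quot_ring_piK x) -(quot_ring_piK y) -(quot_ring_piK z).
move: (repr (x : quot I)) (repr (y : quot I)) (repr (z : quot I)) => a b c.
rewrite (quot_ring_mulE b c) (quot_ring_mulE a b).
by rewrite (quot_ring_mulE a) (quot_ring_mulE _ c) mulrA.
Qed.

Fact quot_ring_mulC : commutative quot_ring_mul.
Proof. by move=> x y; rewrite /quot_ring_mul mulrC. Qed.

Fact quot_ring_mul1 : left_id (quot_ring_pi 1) quot_ring_mul.
Proof. by move=> x; rewrite -(quot_ring_piK x) quot_ring_mulE mul1r. Qed.

Fact quot_ring_mulDl : left_distributive quot_ring_mul +%R.
Proof.
move=> x y z; rewrite -(quot_ring_piK x) -(quot_ring_piK y) -(quot_ring_piK z).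
move: (repr (x : quot I)) (repr (y : quot I)) (repr (z : quot I)) => a b c.
have piD u v : quot_ring_pi u + quot_ring_pi v = quot_ring_pi (u + v).
  exact: esym (raddfD (quot_pi I) u v).
by rewrite piD !quot_ring_mulE piD mulrDl.
Qed.

HB.instance Definition _ := GRing.Zmodule_isComPzRing.Build quot_ring
  quot_ring_mulA quot_ring_mulC quot_ring_mul1 quot_ring_mulDl.

Fact quot_ring_pi_additive : zmod_morphism quot_ring_pi.
Proof. by move=> a b; exact: (raddfB (quot_pi I)). Qed.

Fact quot_ring_pi_multiplicative : monoid_morphism quot_ring_pi.
Proof. by split=> // a b; rewrite -quot_ring_mulE. Qed.

HB.instance Definition _ :=
  GRing.isZmodMorphism.Build R quot_ring quot_ring_pi quot_ring_pi_additive.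
HB.instance Definition _ :=
  GRing.isMonoidMorphism.Build R quot_ring quot_ring_pi
    quot_ring_pi_multiplicative.

End QuotientRing.

Definition ideal_image (R S : comPzRingType) (f : {rmorphism R -> S})
  (I : ideal R) : ideal S := ideal_span (f @` I).

Definition superficial_seq (R : comPzRingType) (I2 I1 : ideal R)
    (k : nat) (x : 'I_k -> R) : Prop :=
  forall i : 'I_k,
    x i \inS I2 /\
    let p : {rmorphism R -> quot_ring (prefix_ideal x i)} :=
      quot_ring_pi (prefix_ideal x i) in
    superficial (ideal_image p I2) (ideal_image p I1) (p (x i)).

Section Koszul.
Variables (R : comPzRingType).

Definition mul_by (x : R) (y : R^o) : R^o := x * y.

Fact mul_by_linear x : linear (mul_by x).
Proof. by move=> a u v; rewrite /mul_by mulrDr; congr (_ + _); exact: mulrCA. Qed.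

HB.instance Definition _ x :=
  GRing.isLinear.Build R R^o R^o *:%R (mul_by x) (mul_by_linear x).

Variables (d : nat) (x : 'I_d -> R) (a : nat -> ideal R).

(* Indexes the standard basis e_S of the j-th exterior power of R^d. *)
Definition kbasis (j : nat) := {S : {set 'I_d} | #|S| == j}.

Definition kterm (j : nat) : lmodType R := {ffun kbasis j -> quot (a j)}.

Definition kcoef (j : nat) (S : {set 'I_d}) (z : kterm j) : quot (a j) :=
  oapp z 0 (insub S).

(* The differential induced by
     e_S |-> \sum_(s in S) (-1)^#{t in S | t < s} x_s e_(S \ s),
   read on coefficients; it is meaningful when x_s a_(j+1) is contained in
   a_j, so that multiplication by x_s induces R/a_(j+1) -> R/a_j. *)
Definition kdiff_fun (j : nat) (z : kterm j.+1) : kterm j :=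
  [ffun T : kbasis j => \sum_(s | s \notin val T)
     (-1) ^+ #|[pred t in val T | (t < s)%N]| *:
       quot_map (mul_by (x s)) (a j.+1) (a j) (kcoef (s |: val T) z)].

Fact kdiff_linear j : linear (@kdiff_fun j).
Proof.
move=> c u v; apply/ffunP => T; rewrite !ffunE scaler_sumr -big_split /=.
apply: eq_bigr => s _; rewrite scalerA mulrC -scalerA -scalerDr -linearP.
congr (_ *: quot_map _ _ _ _); rewrite /kcoef.
by case: insubP => /= [S _ _|_]; rewrite ?ffunE ?scaler0 ?addr0.
Qed.

HB.instance Definition _ j :=
  GRing.isLinear.Build R (kterm j.+1) (kterm j) *:%R (@kdiff_fun j)
    (@kdiff_linear j).

Definition kdiff (j : nat) : {linear kterm j.+1 -> kterm j} := @kdiff_fun j.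

Definition kcycles (j : nat) : submod (kterm j) :=
  if j is j'.+1 then kerS (kdiff j') else fullS.

Definition khomology (j : nat) : lmodType R :=
  subquot (kcycles j) (imS (kdiff j)).

End Koszul.

Section HilbertData.
Variables (R : comPzRingType) (I1 I2 : ideal R) (d : nat).

(* The lengths of H_j(C(0,n)) and H_j(C(1,n)), where C(0,n) and C(1,n) have
   (R/I2^(n-j))^'C(d,j) and (R/(I1 I2^(n-j)))^'C(d,j) in degree j. *)
Definition h0 (x : 'I_d -> R) (j : nat) (n : int) : int :=
  (length (khomology x (fun k => idealXz I2 (n - k%:Z)) j))%:Z.

Definition h1 (x : 'I_d -> R) (j : nat) (n : int) : int :=
  (length (khomology x (fun k => idealM I1 (idealXz I2 (n - k%:Z))) j))%:Z.

(* f_0, ..., f_(d-1) are the Hilbert coefficients of the fiber cone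
   F_I1(I2) = \bigoplus_n I2^n / I1 I2^n; they are determined by this. *)
Definition fiber_cone_coeffs (f : nat -> int) : Prop :=
  exists N : nat, forall n : nat, (N <= n)%N ->
    (length (subquot (idealX I2 n) (idealM I1 (idealX I2 n))))%:Z =
    \sum_(i < d) (-1) ^+ i * f i * ('C(n + d - 1 - i, d - 1 - i))%:Z.

End HilbertData.

(* Main.v *)
(* Let H(n) be the length of I2^n/I1 I2^n, with H(n) = l(R/I1) for n <= 0, and
   let nabla be the backward difference. The lengths of the terms of C(0,n) and
   C(1,n) show that the difference of their Euler characteristics is
   - nabla^d H(n). Since h_0 is the length of R/(J + I2^n), resp. of
   R/(J + I1 I2^n), moving the term j = 0 across turns the bracket of the first
   formula into nabla^d H(n); summing this against binom(n, i) by parts i times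
   leaves f_i at infinity, and at 0 a term that vanishes unless i = d - 1, where
   it is l(R/I1) up to sign.
   The second bracket is the first one with the term j = 1 made explicit: since
   H_1(x; R) = 0, H_1(C(0,n)) is the quotient of the intersection of J and I2^n
   by J I2^(n-1), and similarly for C(1,n). That H_1(x; R) = 0 is depth
   sensitivity: a regular sequence y_1..y_d in m has powers in J, hence
   H_(k+1)(x; R/(y_1..y_k)) = 0 implies H_k(x; R/(y_1..y_(k-1))) = 0, and one
   starts from H_(d+1)(x; R/(y_1..y_d)) = 0. *)

Require Import Defs.
From HB Require Import structures.
From mathcomp Require Import all_boot all_order all_algebra.
From mathcomp Require Import boolp classical_sets functions cardinality fsbigop.
From mathcomp Require Import zify ring.

Set Implicit Arguments.
Unset Strict Implicit.
Unset Printing Implicit Defensive.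

Import Order.TTheory GRing.Theory Num.Theory.

Local Open Scope classical_set_scope.
Local Open Scope ring_scope.

(** * Length of intervals of submodules *)

Section RelativeLength.
Variables (R : comPzRingType) (V : lmodType R).
Implicit Types (L M N P : submod V) (A B : set V).

Lemma submod_eq M N : M = N :> set V -> M = N.
Proof.
case: M N => [M HM] [N HN] /= E; move: E HM HN => -> HM HN.
by congr Submod; exact: Prop_irrelevance.
Qed.

Lemma zero_is_submodule : is_submodule [set 0 : V].
Proof. by split=> // a u v -> ->; rewrite scaler0 addr0. Qed.

Definition zeroS : submod V := Submod zero_is_submodule.

Lemma zeroS_sub N : zeroS `<=` N.
Proof. by move=> _ ->; exact: submod0. Qed.

Lemma span_sub A N : A `<=` N -> Defs.span A `<=` N.
Proof. by move=> AN z; apply; split; [exact: submodP|]. Qed.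

Lemma sub_span A : A `<=` Defs.span A.
Proof. by move=> z Az N [_]; apply. Qed.

Lemma addSP M N z : z \inS addS M N <-> exists u v, [/\ u \inS M, v \inS N & z = u + v].
Proof.
split=> [|[u [v [Mu Nv ->]]]]; last by apply: submodD; apply: sub_span; [left|right].
have sumP : is_submodule [set z | exists u v, [/\ u \inS M, v \inS N & z = u + v]].
  split=> [|a ? ? [u [v [Mu Nv ->]]] [u' [v' [Mu' Nv' ->]]]].
    by exists 0, 0; split; rewrite ?addr0 //; exact: submod0.
  exists (a *: u + u'), (a *: v + v'); split; try exact: submodZD.
  by rewrite scalerDr addrACA.
apply: (@span_sub _ (Submod sumP)) => t [Mt|Nt] /=.
  by exists t, 0; split; rewrite ?addr0 //; exact: submod0.
by exists 0, t; split; rewrite ?add0r //; exact: submod0.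
Qed.

Lemma addSl M N : M `<=` addS M N.
Proof. by move=> z Mz; apply: sub_span; left. Qed.

Lemma addSr M N : N `<=` addS M N.
Proof. by move=> z Nz; apply: sub_span; right. Qed.

Lemma addS_sub M N P : M `<=` P -> N `<=` P -> addS M N `<=` P.
Proof. by move=> MP NP; apply: span_sub; rewrite subUset. Qed.

(** The ends [A] and [B] are plain sets, so that images, [[set 0]] and [setT] can stand there
    without being packaged as submodules. For submodules A inside B these are the chains that
    measure the length of B/A. *)
Definition chain_in A B (n : nat) : Prop :=
  exists p : nat -> submod V,
    [/\ A `<=` p 0%N, p n `<=` B & forall k, (k < n)%N -> p k `<` p k.+1].

Definition finite_length_in A B : Prop :=
  exists b, forall n, chain_in A B n -> (n <= b)%N.

Definition length_in A B : nat := xget 0%N (is_maximum (chain_in A B)).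

Lemma chain_mono (p : nat -> submod V) n k l :
  (forall k, (k < n)%N -> p k `<` p k.+1) -> (k <= l <= n)%N -> p k `<=` p l.
Proof.
move=> pS; elim: l => [|l IHl] /andP[kl ln]; first by have -> : k = 0%N by lia.
have [->//|kl'] := eqVneq k l.+1.
by apply: subset_trans (proj1 (pS l ln)); apply: IHl; lia.
Qed.

Lemma chain_in_sub A A' B B' n :
  A' `<=` A -> B `<=` B' -> chain_in A B n -> chain_in A' B' n.
Proof.
move=> sA sB [p [Ap pB pS]]; exists p; split=> //.
  exact: subset_trans Ap.
exact: subset_trans sB.
Qed.

Lemma chain_in0 N B : N `<=` B -> chain_in N B 0.
Proof. by move=> NB; exists (fun=> N); split. Qed.

Lemma is_maximum_inj (P : nat -> Prop) k l :
  is_maximum P k -> is_maximum P l -> k = l.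
Proof. by move=> [Pk kP] [Pl lP]; apply/eqP; rewrite eqn_leq lP // kP. Qed.

Lemma length_inP N B :
  N `<=` B -> finite_length_in N B -> is_maximum (chain_in N B) (length_in N B).
Proof.
move=> NB [b bP]; have [n nP] : exists n, is_maximum (chain_in N B) n.
  have ex : exists n, `[< chain_in N B n >] by exists 0%N; apply/asboolP/chain_in0.
  have ub n : `[< chain_in N B n >] -> (n <= b)%N by move/asboolP; exact: bP.
  case: (ex_maxnP ex ub) => n /asboolP nP nmax.
  by exists n; split=> // k kP; apply: nmax; apply/asboolP.
by rewrite /length_in; case: xgetP => [k _ //|/(_ n)].
Qed.

Lemma finite_length_in_sub A A' B B' :
  A `<=` A' -> B' `<=` B -> finite_length_in A B -> finite_length_in A' B'.
Proof. by move=> sA sB [b bP]; exists b => n /(chain_in_sub sA sB); exact: bP. Qed.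

Lemma chain_in_rcons A P P' n :
  chain_in A P n -> P `<` P' -> chain_in A P' n.+1.
Proof.
move=> [p [Ap pP pS]] [PP' P'P]; exists (fun k => if (k <= n)%N then p k else P').
split=> [||k kn] /=; rewrite ?leqnn ?ltnn //=.
rewrite -ltnS kn /=.
case: ltnP => [/pS //|nk]; have -> : k = n by lia.
by split=> [|P'p]; [exact: subset_trans PP'|apply: P'P; exact: subset_trans pP].
Qed.

Lemma chain_in_cat A M B k l :
  chain_in A M k -> chain_in M B l -> chain_in A B (k + l).
Proof.
move=> [p [Ap pM pS]] [q [Mq qB qS]].
(* The term [q 0] is skipped: since [p k] lies in [q 0], the step from [p k] to [q 1] is still
   strict, and k + l steps remain. *)
exists (fun t => if (t <= k)%N then p t else q (t - k)%N); split=> /= [//||t tkl].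
  case: leqP => [?|?]; last by rewrite addKn.
  have l0 : l = 0%N by lia.
  rewrite l0 addn0; apply: subset_trans pM _; apply: subset_trans Mq _.
  by rewrite l0 in qB.
have [tk|tk|tk] := ltngtP t k; [exact: pS | | subst t].
  by rewrite subSn ?(ltnW tk) //; apply: qS; lia.
have pq : p k `<=` q 0%N by exact: subset_trans Mq.
have [q01 q10] : q 0%N `<` q 1%N by apply: qS; lia.
rewrite subSnn; split; first exact: subset_trans q01.
by move=> q1; apply: q10; exact: subset_trans q1 pq.
Qed.

(** By the modular law, each strict step of the chain stays strict after intersecting with [M] or
    after adding [M]. This gives the subadditivity of length. *)
Lemma chain_in_split A M N n : A `<=` M -> chain_in A N n ->
  exists k l, [/\ (n <= k + l)%N, chain_in A M k & chain_in M (addS N M) l].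
Proof.
move=> AM [p [Ap pN pS]].
suff [k [l [nkl ck cl]]] : exists k l, [/\ (n <= k + l)%N,
    chain_in A (capS (p n) M) k & chain_in M (addS (p n) M) l].
  exists k, l; split=> //; first by apply: chain_in_sub ck => // z [].
  apply: chain_in_sub cl => //; apply: addS_sub; last exact: addSr.
  by apply: subset_trans pN _; exact: addSl.
elim: n {pN} pS => [|n IHn] pS.
  exists 0%N, 0%N; split=> //; last by apply: chain_in0; exact: addSr.
  by exists (fun=> capS (p 0%N) M); split=> // z Az; split; [exact: Ap|exact: AM].
have [|k [l [nkl ck cl]]] := IHn; first by move=> k kn; apply: pS; lia.
have [pp pp'] := pS n (ltnSn n).
have subC : capS (p n) M `<=` capS (p n.+1) M by move=> z [/pp].
have subA : addS (p n) M `<=` addS (p n.+1) M.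
  by apply: addS_sub; [apply: subset_trans pp _; exact: addSl|exact: addSr].
(* If the intersections agree, the sums must differ: z = u + v with u in [p n] and v in [M] puts v =
   z - u in the common intersection, hence z in [p n]. *)
have [eqC|neC] := pselect (capS (p n.+1) M `<=` capS (p n) M); last first.
  exists k.+1, l; split; [lia|exact: chain_in_rcons ck _|exact: chain_in_sub cl].
exists k, l.+1; split; [lia|exact: chain_in_sub ck|].
apply: chain_in_rcons cl _; split=> // eqA; apply: pp' => z pz.
have /eqA/addSP[u [v [pu Mv zE]]] := @addSl (p n.+1) M _ pz.
have [|pv _] := eqC v; last by rewrite zE; exact: submodD.
by split=> //; have -> : v = z - u; [rewrite zE addrAC subrr add0r|apply: submodB => //; exact: pp].
Qed.

Lemma finite_length_in_trans A M N :
  A `<=` M -> M `<=` N -> finite_length_in A M -> finite_length_in M N ->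
  finite_length_in A N.
Proof.
move=> AM MN [b bP] [c cP]; exists (b + c)%N => n /(chain_in_split AM).
move=> [k [l [nkl /bP kb cl]]]; apply: leq_trans nkl _; apply: leq_add => //.
by apply: cP; apply: chain_in_sub cl => //; exact: addS_sub.
Qed.

Lemma finite_length_in_transT A M :
  A `<=` M -> finite_length_in A M -> finite_length_in M setT -> finite_length_in A setT.
Proof. by move=> AM; exact: (@finite_length_in_trans _ _ fullS). Qed.

(** Concatenating maximal chains gives one inequality, splitting a maximal chain at [M] gives the
    other. *)
Lemma length_inD L M N : L `<=` M -> M `<=` N -> finite_length_in L N ->
  length_in L N = (length_in L M + length_in M N)%N.
Proof.
move=> LM MN fLN; have LN : L `<=` N by exact: subset_trans MN.
have [cLN maxLN] := length_inP LN fLN.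
have [cLM maxLM] := length_inP LM (finite_length_in_sub (@subset_refl _ _) MN fLN).
have [cMN maxMN] := length_inP MN (finite_length_in_sub LM (@subset_refl _ _) fLN).
apply/eqP; rewrite eqn_leq maxLN ?andbT; last exact: chain_in_cat cLM cMN.
have [k [l [nkl /maxLM ck cl]]] := chain_in_split LM cLN.
apply: leq_trans nkl _; apply: leq_add => //.
by apply: maxMN; apply: chain_in_sub cl => //; exact: addS_sub.
Qed.

Lemma chain_in_self N n : chain_in N N n -> n = 0%N.
Proof.
move=> [p [Np pN pS]]; case: n => // n in pN pS *.
case: (pS n) => // _ []; apply: subset_trans pN _; apply: subset_trans Np _.
by apply: (chain_mono pS); rewrite leqnSn.
Qed.

Lemma finite_length_in_self N : finite_length_in N N.
Proof. by exists 0%N => n /chain_in_self ->. Qed.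

Lemma length_in_self N : length_in N N = 0%N.
Proof.
have [cN _] := length_inP (@subset_refl _ N) (finite_length_in_self N).
exact: chain_in_self cN.
Qed.

Lemma length_chain : length V = length_in [set 0] [set: V].
Proof.
congr (xget 0%N (is_maximum _)); apply/funext => n; apply/propext; split.
  by move=> [p pS]; exists p; split=> // z ->; exact: submod0.
by move=> [p [_ _ pS]]; exists p.
Qed.

End RelativeLength.

Arguments zeroS {R V}.

(** * Intervals of submodules under linear maps *)

Section Image.
Variables (R : comPzRingType) (U V : lmodType R) (f : {linear U -> V}).
Implicit Types (L M N : submod U).

Lemma image_is_submodule N : is_submodule (f @` N).
Proof.
split=> [|a ? ? [u Nu <-] [v Nv <-]].
  by exists 0; [exact: submod0|exact: linear0].
by exists (a *: u + v); [exact: submodZD|rewrite linearP].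
Qed.

Definition imageS N : submod V := Submod (image_is_submodule N).

(** Chains go forward by images and back by preimages cut down to [M]. The kernel condition makes
    every term between [N] and [M] recoverable from its image, so strictness survives. *)
Lemma chain_in_image N M n :
  N `<=` M -> (forall u, u \inS M -> f u = 0 -> u \inS N) ->
  chain_in (f @` N) (f @` M) n <-> chain_in N M n.
Proof.
move=> NM kerN; split=> [[p [Np pM pS]]|[p [Np pM pS]]].
  exists (fun k => capS (comapS f (p k)) M); split=> [u Nu|u []//|k kn].
    by split; [apply: Np; exists u|exact: NM].
  have [pk kp] := pS _ kn; split=> [u [pu Mu]|sub]; first by split=> //; exact: pk.
  apply: kp => v pv; have pvn : v \inS p n by apply: (chain_mono pS _ pv); rewrite kn leqnn.
  have [u Mu fu] := pM v pvn.
  by have [|] := sub u; [split=> //; rewrite /= /preimage /= fu|rewrite /= /preimage /= fu].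
exists (fun k => imageS (p k)); split; [exact: image_subset|exact: image_subset|].
move=> k kn; have [pk kp] := pS _ kn; split=> [|sub]; first exact: image_subset.
apply: kp => u pu; have [|v pv fvu] := sub (f u); first by exists u.
have kM : p k.+1 `<=` M by apply: subset_trans pM; apply: chain_mono pS _; rewrite kn /=.
have Npk : N `<=` p k by apply: subset_trans Np _; apply: chain_mono pS _; lia.
rewrite -(subrK v u); apply: submodD => //; apply/Npk/kerN.
  by apply: submodB; apply: kM => //; exact: pk.
by rewrite linearB /= fvu subrr.
Qed.

Lemma length_in_image N M :
  N `<=` M -> (forall u, u \inS M -> f u = 0 -> u \inS N) ->
  length_in (f @` N) (f @` M) = length_in N M.
Proof.
move=> NM kerN; congr (xget 0%N (is_maximum _)).
by apply/funext => n; apply/propext; exact: chain_in_image.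
Qed.

Lemma finite_length_in_image N M :
  N `<=` M -> (forall u, u \inS M -> f u = 0 -> u \inS N) ->
  finite_length_in (f @` N) (f @` M) <-> finite_length_in N M.
Proof.
by move=> NM kerN; split=> -[b bP]; exists b => n /(chain_in_image _ NM kerN)/bP.
Qed.

Lemma length_in_comap (N M : submod V) : range f = setT -> N `<=` M ->
  length_in (comapS f N) (comapS f M) = length_in N M.
Proof.
move=> fT NM; have fK (P : submod V) : f @` comapS f P = P.
  apply/seteqP; split=> [_ [u Pu <-] //|v Pv].
  have : range f v by rewrite fT.
  by move=> [u _ fu]; exists u; rewrite //= /preimage /= fu.
rewrite -[in RHS](fK N) -[in RHS](fK M) length_in_image // => [u|u _ u0]; first exact: NM.
by rewrite /= /preimage /= u0; exact: submod0.
Qed.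

End Image.

(** * Lengths of quotients and subquotients *)

Section Quotients.
Variables (R : comPzRingType) (V : lmodType R).
Implicit Types (L M N : submod V).

Lemma quot_pi_eq0 N u : quot_pi N u = 0 <-> u \inS N.
Proof. by rewrite -(linear0 (quot_pi N)) quot_piP subr0. Qed.

Lemma image_quot_pi_self N : quot_pi N @` N = [set 0].
Proof.
apply/seteqP; split=> [_ [u Nu <-]|_ ->]; first exact/quot_pi_eq0.
by exists 0; [exact: submod0|rewrite linear0].
Qed.

Lemma image_quot_piT N : quot_pi N @` setT = setT.
Proof. by apply/seteqP; split=> // z _; exists (repr z) => //; exact: quot_piK. Qed.

Lemma length_quot N : length (quot N) = length_in N setT.
Proof.
rewrite length_chain -(@image_quot_pi_self N) -(image_quot_piT N).
by apply: (@length_in_image _ _ _ (quot_pi N) N fullS) => // u _ /quot_pi_eq0.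
Qed.

Lemma finite_length_in_quot N : finite_length_in N setT ->
  finite_length_in [set 0 : quot N] setT.
Proof.
rewrite -(@image_quot_pi_self N) -(image_quot_piT N) => fN.
by apply/(@finite_length_in_image _ _ _ (quot_pi N) N fullS) => // u _ /quot_pi_eq0.
Qed.

End Quotients.

Section Subquotients.
Variables (R : comPzRingType) (V : lmodType R).
Implicit Types (L M N : submod V).

(** Trades quotient types for intervals in a fixed ambient module, where all further lengths are
    computed. *)
Lemma length_subquot M N : N `<=` M -> length (subquot M N) = length_in N M.
Proof.
move=> NM; rewrite length_quot.
rewrite -(@length_in_image _ _ _ (val : {linear submod_type M -> V}) _ fullS) //.
  congr length_in; apply/seteqP.
    split=> [_ [u Nu <-] //|u Nu].
    have uM : u \in submod_pred M by apply/asboolP/NM.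
    by exists (exist _ u uM).
  split=> [_ [[u uM] _ <-]|u Mu]; first exact/asboolP.
  have uM : u \in submod_pred M by exact/asboolP.
  by exists (exist _ u uM).
by move=> u _ /= u0; rewrite /preimage /= u0; exact: submod0.
Qed.

(** The second isomorphism theorem: both intervals have the same image under [quot_pi N]. *)
Lemma chain_in_capS M N n : chain_in (capS M N) M n <-> chain_in N (addS M N) n.
Proof.
rewrite -(@chain_in_image _ _ _ (quot_pi N) (capS M N) M); last 2 first.
- by move=> u [].
- by move=> u Mu /quot_pi_eq0.
rewrite -(@chain_in_image _ _ _ (quot_pi N) N (addS M N)); last 2 first.
- exact: addSr.
- by move=> u _ /quot_pi_eq0.
suff [-> ->] : quot_pi N @` capS M N = quot_pi N @` N /\
    quot_pi N @` M = quot_pi N @` addS M N by [].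
split.
  rewrite image_quot_pi_self; apply/seteqP; split=> [_ [u [_ /quot_pi_eq0 u0] <-] //|_ ->].
  by exists 0; [split; exact: submod0|rewrite linear0].
apply/seteqP; split; first by apply: image_subset; exact: addSl.
move=> _ [_ /addSP[u [v [Mu Nv ->]]] <-]; exists u => //.
by apply/quot_piP; rewrite opprD addrA subrr add0r; exact: submodN.
Qed.

Lemma length_in_capS M N : length_in (capS M N) M = length_in N (addS M N).
Proof.
congr (xget 0%N (is_maximum _)).
by apply/funext => n; apply/propext; exact: chain_in_capS.
Qed.

Lemma finite_length_in_capS M N :
  finite_length_in (capS M N) M -> finite_length_in N (addS M N).
Proof. by move=> [b bP]; exists b => n /chain_in_capS/bP. Qed.

End Subquotients.

(** * Ideals of finite colength *)

Section Ideals.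
Variable R : comPzRingType.
Implicit Types I J K L Q : ideal R.

Lemma idealM_mem I J (a b : R) : a \inS I -> b \inS J -> a * b \inS idealM I J.
Proof. by move=> Ia Jb; apply: sub_span; exists a, b. Qed.

Lemma idealM_sub I J K :
  (forall a b : R, a \inS I -> b \inS J -> a * b \inS K) -> idealM I J `<=` K.
Proof. by move=> IJK; apply: span_sub => _ [a [b [Ia Jb ->]]]; exact: IJK. Qed.

Lemma idealM_subS I I' J J' : I `<=` I' -> J `<=` J' -> idealM I J `<=` idealM I' J'.
Proof. by move=> sI sJ; apply: idealM_sub => a b /sI Ia /sJ Jb; exact: idealM_mem. Qed.

Lemma ideal_mulr I (a b : R) : b \inS I -> a * b \inS I.
Proof. exact: (@submodZ _ R^o). Qed.

Lemma ideal_mull I (a b : R) : a \inS I -> a * b \inS I.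
Proof. by rewrite mulrC; exact: ideal_mulr. Qed.

Lemma idealM_subl I J : idealM I J `<=` I.
Proof. by apply: idealM_sub => a b Ia _; exact: ideal_mull. Qed.

Lemma idealM_subr I J : idealM I J `<=` J.
Proof. by apply: idealM_sub => a b _; exact: ideal_mulr. Qed.

Lemma idealM_full I : idealM I fullS = I.
Proof.
apply/submod_eq/seteqP; split; first exact: idealM_subl.
by move=> a Ia; rewrite -[a]mulr1; exact: idealM_mem.
Qed.

Lemma idealMA I J K : idealM (idealM I J) K = idealM I (idealM J K).
Proof.
apply/submod_eq/seteqP; split.
  apply: idealM_sub => z c IJz Kc; rewrite mulrC.
  suff sub : idealM I J `<=` comapS (mul_by c) (idealM I (idealM J K)) by exact: sub z IJz.
  apply: idealM_sub => a b Ia Jb; change (c * (a * b) \inS idealM I (idealM J K)).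
  by rewrite mulrCA [c * b]mulrC; do 2?apply: idealM_mem.
apply: idealM_sub => a z Ia JKz.
suff sub : idealM J K `<=` comapS (mul_by a) (idealM (idealM I J) K) by exact: sub z JKz.
apply: idealM_sub => b c Jb Kc; change (a * (b * c) \inS idealM (idealM I J) K).
by rewrite mulrA; do 2?apply: idealM_mem.
Qed.

Lemma idealM_genP (k : nat) (x : 'I_k -> R) I z :
  z \inS idealM (ideal_gen x) I <->
  exists c : 'I_k -> R, (forall i, c i \inS I) /\ z = \sum_i c i * x i.
Proof.
split=> [|[c [Ic ->]]]; last first.
  apply: (big_ind (fun z => z \inS _)) => [||i _]; first exact: submod0.
    exact: submodD.
  by rewrite mulrC; apply: idealM_mem => //; apply: sub_span; exists i.
have combP : is_submodule (V := R^o)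
    [set z | exists c : 'I_k -> R, (forall i, c i \inS I) /\ z = \sum_i c i * x i].
  split=> [|a ? ? [c [Ic ->]] [c' [Ic' ->]]].
    exists (fun=> 0); split=> [i|]; first exact: submod0.
    by rewrite big1 // => i _; rewrite mul0r.
  exists (fun i => a * c i + c' i); split=> [i|]; first exact: submodZD.
  rewrite [a *: _]mulr_sumr -big_split; apply: eq_bigr => i _ /=.
  by rewrite mulrDl mulrA.
apply: (idealM_sub (K := Submod combP)) => a b ga Ib.
suff sub : ideal_gen x `<=` comapS (mul_by b) (Submod combP).
  by rewrite mulrC; exact: sub a ga.
apply: span_sub => _ [i _ <-] /=; rewrite /preimage /=.
exists (fun j => if j == i then b else 0); split=> [j|].
  by case: eqP => // _; exact: submod0.
rewrite (bigD1 i) //= eqxx big1 ?addr0 // => j /negbTE ->.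
by rewrite mul0r.
Qed.

Lemma ideal_genP (k : nat) (x : 'I_k -> R) z :
  z \inS ideal_gen x <-> exists c : 'I_k -> R, z = \sum_i c i * x i.
Proof.
rewrite -[ideal_gen x]idealM_full idealM_genP.
by split=> -[c]; [case=> _ ->; exists c|move=> ->; exists c].
Qed.

(** Generators are added one at a time, so that finiteness of length can be proved by induction on
    the list. *)
Definition adjoin (s : seq R) L : ideal R :=
  foldr (fun g L => addS (imS (mul_by g)) L) L s.

Lemma adjoin_sub s L : L `<=` adjoin s L.
Proof.
elim: s => [//|g s IHs]; apply: subset_trans IHs _.
exact: addSr.
Qed.

Lemma ideal_gen_adjoin (k : nat) (g : 'I_k -> R) L :
  ideal_gen g `<=` adjoin (codom g) L.
Proof.
apply: span_sub => _ [i _ <-]; have := codom_f g i.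
elim: (codom g) => // h s IHs; rewrite inE => /predU1P[->|/IHs gi].
  by apply: addSl; exists 1 => //; exact: mulr1.
exact: addSr.
Qed.

(* (L + Rg)/L is a quotient of R/Q *)
Lemma finite_length_adjoin1 L Q (g : R) : (forall q : R, q \inS Q -> q * g \inS L) ->
  finite_length_in Q setT -> finite_length_in L (addS (imS (mul_by g)) L).
Proof.
move=> QL fQ; apply: finite_length_in_capS.
have fC : finite_length_in (comapS (mul_by g) L) [set: R].
  apply: finite_length_in_sub fQ => // q Qq.
  by rewrite /= /preimage /= /mul_by mulrC; exact: QL.
have {fC} : finite_length_in (mul_by g @` comapS (mul_by g) L) (mul_by g @` fullS).
  apply/finite_length_in_image => // u _ u0.
  by rewrite /= /preimage /= u0; exact: submod0.
apply: finite_length_in_sub => //.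
by move=> _ [u Lu <-]; split=> //; exists u.
Qed.

Lemma finite_length_adjoin s L Q : (forall q g : R, q \inS Q -> g \in s -> q * g \inS L) ->
  finite_length_in Q setT -> finite_length_in L (adjoin s L).
Proof.
move=> + fQ; elim: s => [|g s IHs] QL.
  exact: finite_length_in_self.
apply: finite_length_in_trans (IHs _) (finite_length_adjoin1 _ fQ).
- exact: adjoin_sub.
- exact: addSr.
- by move=> q h Qq sh; apply: QL; rewrite // inE sh orbT.
- by move=> q Qq; apply: adjoin_sub; apply: QL; rewrite // inE eqxx.
Qed.

(** In the filtration by L + (g^k), each layer is cyclic and killed by L + (g), hence of finite
    length; at k = n the filtration has reached [L]. *)
Lemma finite_length_adjoin_nil L (g : R) n : g ^+ n \inS L ->
  finite_length_in (addS (imS (mul_by g)) L) setT -> finite_length_in L setT.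
Proof.
move=> Lgn fg; pose Lg k : ideal R := addS (imS (mul_by (g ^+ k))) L.
have LgS k : Lg k.+1 `<=` Lg k.
  apply: addS_sub; last exact: addSr.
  by move=> _ [u _ <-]; apply: addSl; exists (g * u) => //; rewrite /= /mul_by exprSr mulrA.
have fL k : finite_length_in (Lg k) setT.
  elim: k => [|k IHk].
    apply: finite_length_in_sub fg => // u _; apply: addSl.
    by exists u => //; exact: mul1r.
  apply: (finite_length_in_transT (M := Lg k)) IHk => //.
  apply: finite_length_in_sub (finite_length_adjoin1 (L := Lg k.+1) (g := g ^+ k) _ fg) => //.
    apply: addS_sub; first exact: addSl.
    by apply: (@subset_trans _ (Lg k.+1)); [exact: (@addSr _ R^o)|exact: addSr].
  move=> _ /addSP[_ [v [[u _ <-] Lv ->]]]; rewrite mulrDl; apply: submodD.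
    apply: addSl; exists u => //=; rewrite /mul_by exprSr; ring.
  by apply: addSr; exact: ideal_mull.
apply: finite_length_in_sub (fL n) => //; apply: addS_sub => // _ [u _ <-].
exact: ideal_mull.
Qed.

(** In a chain of two steps above [m] the middle term would be a proper ideal, hence equal to [m],
    against the first strict step. *)
Lemma finite_length_max (m : ideal R) : maximal_ideal m -> finite_length_in m setT.
Proof.
move=> [m1 mmax]; exists 1%N => -[//|[//|n]] [p [mp _ pS]].
have [p01 p10] := pS 0%N isT; have [p12 p21] := pS 1%N isT.
have p1 : ~ 1 \inS p 1%N.
  by move=> p1; apply: p21 => u _; rewrite -[u]mulr1; exact: ideal_mulr.
by case: p10; rewrite (mmax _ p1) //; exact: subset_trans p01.
Qed.

(** Adjoining generators of [m] to [I] gives an ideal of finite colength. The generators are then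
    removed one by one, each being nilpotent modulo [I]. *)
Lemma finite_length_primary (m I : ideal R) :
  noetherian R -> maximal_ideal m -> m `<=` radical I -> finite_length_in I setT.
Proof.
move=> noeth mmax mI; have [k [g mE]] := noeth m.
have gm i : g i \inS m by rewrite mE; apply: sub_span; exists i.
suff fs s : (forall h, h \in s -> h \inS m) ->
    finite_length_in (adjoin s I) setT -> finite_length_in I setT.
  apply: (fs (codom g)) => [_ /codomP[i ->] //|].
  apply: finite_length_in_sub (finite_length_max mmax) => //.
  by rewrite mE; exact: ideal_gen_adjoin.
elim: s => // h s IHs sm fI; apply: IHs => [u us|].
  by apply: sm; rewrite inE us orbT.
have [|n In] := mI h; first by apply: sm; rewrite inE eqxx.
apply: (finite_length_adjoin_nil (g := h) (n := n)) fI; exact: adjoin_sub.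
Qed.

(** The module I/IJ is generated by finitely many elements, each killed by [J]. *)
Lemma finite_length_mul I J : noetherian R ->
  finite_length_in I setT -> finite_length_in J setT ->
  finite_length_in (idealM I J) setT.
Proof.
move=> noeth fI fJ; have [k [g IE]] := noeth I.
have gI i : g i \inS I by rewrite IE; apply: sub_span; exists i.
apply: (finite_length_in_transT (M := I)) fI => //; first exact: idealM_subl.
apply: finite_length_in_sub (finite_length_adjoin (s := codom g) (L := idealM I J) _ fJ) => //.
  by rewrite IE; exact: ideal_gen_adjoin.
by move=> q _ Jq /codomP[i ->]; rewrite mulrC; exact: idealM_mem.
Qed.

Lemma finite_lengthX I n : noetherian R -> finite_length_in I setT ->
  finite_length_in (idealX I n) setT.
Proof.
move=> noeth fI; elim: n => [|n IHn]; last exact: finite_length_mul.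
by apply: finite_length_in_sub fI.
Qed.

End Ideals.

(** * Koszul homology *)

Section KoszulDifferential.
Variables (R : comPzRingType) (d : nat).
Implicit Types (x c : 'I_d -> R) (g : {set 'I_d} -> R) (S T : {set 'I_d}).

Definition ksign T (s : 'I_d) : R := (-1) ^+ #|[pred t in T | (t < s)%N]|.

Lemma ksign_sqr T s : ksign T s * ksign T s = 1.
Proof. by rewrite -expr2 sqrr_sign. Qed.

Lemma ksignU1 T r s : r \notin T -> ksign (r |: T) s = (-1) ^+ (r < s)%N * ksign T s.
Proof.
move=> rT; rewrite /ksign -exprD; congr (_ ^+ _).
rewrite (cardD1 r) inE /= finset.setU11 /=; congr (_ + _)%N; apply: eq_card => t.
by rewrite !inE; case: eqVneq => [->|//]; rewrite (negbTE rT).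
Qed.

Lemma ksign_swap T r s : r \notin T -> s \notin T -> r != s ->
  ksign T s * ksign (s |: T) r = - (ksign T r * ksign (r |: T) s).
Proof.
move=> rT sT; rewrite !ksignU1 // neq_ltn => /orP[] rs.
  by rewrite rs ltnNge ltnW //=; ring.
by rewrite rs ltnNge ltnW //=; ring.
Qed.

Lemma ksign_swapU T r s : r \notin T -> s \notin T -> r != s ->
  ksign T r * ksign T s = - (ksign (r |: T) s * ksign (s |: T) r).
Proof.
move=> rT sT; rewrite !ksignU1 // neq_ltn => /orP[] rs.
  by rewrite rs ltnNge ltnW //=; ring.
by rewrite rs ltnNge ltnW //=; ring.
Qed.

(** The Koszul differential over R in all degrees at once: a chain of degree j is given by its
    coefficients on sets of size j. Coefficients in R/A are treated by congruences modulo A. *)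
Definition kd x g T : R := \sum_(s | s \notin T) ksign T s * (x s * g (s |: T)).

(** Left exterior multiplication by the degree one element with coefficients [c]. *)
Definition kh c g S : R := \sum_(s in S) ksign (S :\ s) s * (c s * g (S :\ s)).

Lemma kdB x g g' T : kd x (fun S => g S - g' S) T = kd x g T - kd x g' T.
Proof. by rewrite -sumrB; apply: eq_bigr => s _; ring. Qed.

Lemma kdD x g g' T : kd x (fun S => g S + g' S) T = kd x g T + kd x g' T.
Proof. by rewrite -big_split; apply: eq_bigr => s _ /=; ring. Qed.

Lemma kdZ x a g T : kd x (fun S => a * g S) T = a * kd x g T.
Proof. by rewrite /kd big_distrr; apply: eq_bigr => s _ /=; ring. Qed.

Lemma eq_kd x g g' T : (forall S, #|S| = #|T|.+1 -> g S = g' S) -> kd x g T = kd x g' T.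
Proof. by move=> E; apply: eq_bigr => s sT; rewrite E // cardsU1 sT. Qed.

(** Adjoining s and then r to [T] gives the same set as the opposite order, with opposite sign by
    [ksign_swap]. *)
Lemma kd_kd x g T : kd x (kd x g) T = 0.
Proof.
pose A s r := ksign T s * ksign (s |: T) r * (x s * x r * g (r |: (s |: T))).
have -> : kd x (kd x g) T = \sum_s \sum_(r | [&& s \notin T, r \notin T & r != s]) A s r.
  rewrite [LHS]big_mkcond; apply: eq_bigr => s _; case: ifPn => sT /=; last first.
    by rewrite big_pred0.
  rewrite !big_distrr; apply: eq_big => [r|r _] /=; last by rewrite /A; ring.
  by rewrite !inE negb_or andbC.
(* The ordered pairs are cut into increasing and decreasing ones; swapping the latter makes the two
   halves cancel term by term. *)
rewrite pair_big_dep /= (bigID (fun p : 'I_d * 'I_d => p.1 < p.2)%N) /=.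
rewrite [X in _ + X](reindex_inj (can_inj swap_pairK)) /=.
rewrite [X in _ + X](eq_bigl (fun p : 'I_d * 'I_d =>
    [&& p.1 \notin T, p.2 \notin T & p.2 != p.1] && (p.1 < p.2)%N)) => [|[s r]] /=.
  rewrite -big_split big1 // => -[s r] /= /andP[/and3P[sT rT rs] _].
  have -> : A r s = ksign T r * ksign (r |: T) s * (x s * x r * g (r |: (s |: T))).
    by rewrite /A (finset.setUCA [set s]%SET); ring.
  by rewrite /A ksign_swap // 1?eq_sym //; ring.
rewrite -leqNgt leq_eqVlt val_eqE (eq_sym r s).
by case: eqVneq => _ /=; rewrite ?andbF // andbCA.
Qed.

(** The diagonal terms give c_s x_s g(T), for s outside [T] from the first summand and for s in [T]
    from the second; the others cancel by [ksign_swapU]. So every element of the ideal (x) acts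
    null-homotopically. *)
Lemma kd_kh x c g T :
  kd x (kh c g) T + kh c (kd x g) T = (\sum_s c s * x s) * g T.
Proof.
pose X s r := ksign T s * ksign ((s |: T) :\ r) r * (x s * c r * g ((s |: T) :\ r)).
have -> : kd x (kh c g) T =
    \sum_(s | s \notin T) c s * x s * g T + \sum_(s | s \notin T) \sum_(r in T) X s r.
  rewrite -big_split; apply: eq_bigr => s sT /=.
  rewrite /kh (bigD1 s) ?finset.setU11 //= finset.setU1K // mulrDr mulrDr; congr (_ + _).
    by rewrite -[RHS]mul1r -(ksign_sqr T s); ring.
  rewrite !big_distrr; apply: eq_big => [r|r _] /=; last by rewrite /X; ring.
  by rewrite !inE; case: eqVneq => [->|]; rewrite ?(negbTE sT) //= andbT.
have -> : kh c (kd x g) T =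
    \sum_(r in T) c r * x r * g T - \sum_(r in T) \sum_(s | s \notin T) X s r.
  rewrite -sumrB; apply: eq_bigr => r rT.
  rewrite /kd (bigD1 r) ?finset.setD11 //= finset.setD1K // mulrDr mulrDr; congr (_ + _).
    by rewrite -[RHS]mul1r -(ksign_sqr (T :\ r) r); ring.
  rewrite !big_distrr -sumrN; apply: eq_big => [s|s /andP[sTr sr]] /=.
    by rewrite !inE negb_and negbK; case: eqVneq => [->|]; rewrite ?rT ?andbF ?andbT.
  have sT : s \notin T by move: sTr; rewrite !inE sr.
  have E : (s |: T) :\ r = s |: (T :\ r).
    by apply/setP => t; rewrite !inE; case: (eqVneq t s) => [->|//]; rewrite sr.
  rewrite /X E; have rTr : r \notin T :\ r by rewrite finset.setD11.
  have := ksign_swapU rTr sTr; rewrite eq_sym finset.setD1K // => /(_ sr) E'.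
  transitivity (ksign (T :\ r) r * ksign (T :\ r) s * (x s * c r * g (s |: T :\ r))).
    by ring.
  by rewrite E'; ring.
rewrite exchange_big addrACA subrr addr0 mulr_suml [RHS](bigID (mem T)) /=.
by rewrite addrC.
Qed.

Lemma kh_in (A : ideal R) c g j : (forall T, #|T|.+1 = j -> g T \inS A) ->
  forall S, #|S| = j -> kh c g S \inS A.
Proof.
move=> gA S Sj; apply: (big_ind (fun z => z \inS A)) => [||s sS].
- exact: submod0.
- exact: submodD.
- by do 2!apply: ideal_mulr; apply: gA; rewrite -Sj (cardsD1 s S) sS.
Qed.

Lemma kd_in (A : ideal R) x g j : (forall S, #|S| = j.+1 -> g S \inS A) ->
  forall T, #|T| = j -> kd x g T \inS A.
Proof.
move=> gA T Tj; apply: (big_ind (fun z => z \inS A)) => [||s sT].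
- exact: submod0.
- exact: submodD.
- by do 2!apply: ideal_mulr; apply: gA; rewrite cardsU1 sT Tj.
Qed.

(* vanishing of H_j(x; R/A) *)
Definition koszul_exact x (A : ideal R) (j : nat) : Prop :=
  forall g, (forall T, #|T|.+1 = j -> kd x g T \inS A) ->
  exists w, forall S, #|S| = j -> g S - kd x w S \inS A.

(* A multiple y^N z of a cycle z mod A is the boundary of some w because
   y^N in (x) is null-homotopic; w is then a cycle mod B, hence a boundary mod
   A plus y w', and cancelling y shows that y^(N-1) z is the boundary of w'. *)
Lemma koszul_exact_regular x (A B : ideal R) (y : R) j N :
  y ^+ N \inS ideal_gen x -> (forall r : R, y * r \inS A -> r \inS A) ->
  (forall r, r \inS B <-> exists a b : R, a \inS A /\ r = a + y * b) ->
  koszul_exact x B j.+1 -> koszul_exact x A j.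
Proof.
move=> /ideal_genP[c yN] yreg BP exB g gA.
have {yN} : exists w, forall S, #|S| = j -> y ^+ N * g S - kd x w S \inS A.
  exists (kh c g) => S Sj; rewrite yN -kd_kh addrAC subrr add0r.
  exact: kh_in gA _ Sj.
elim: N => [|N IHN] [w wA]; first by exists w => S /wA; rewrite expr0 mul1r.
apply: IHN; have [T|v vB] := exB w.
  move=> [Tj]; apply/BP; have := wA T Tj.
  exists (- (y ^+ N.+1 * g T - kd x w T)), (y ^+ N * g T); split.
    exact: submodN.
  by rewrite exprS; ring.
(* The decomposition exists only on sets of size j + 1; the default (0, 0) elsewhere lets [choice]
   produce functions on all sets. *)
have : forall S, exists ab : R * R,
    #|S| = j.+1 -> ab.1 \inS A /\ w S - kd x v S = ab.1 + y * ab.2.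
  move=> S; have [Sj|Sj] := eqVneq #|S| j.+1; last first.
    by exists (0, 0) => Sj'; case/eqP: Sj.
  by have /BP[a [b ab]] := vB S Sj; exists (a, b).
move=> /choice[ab abP]; exists (fun S => (ab S).2) => S Sj; apply: yreg.
have wE : kd x w S = kd x (fun S => (ab S).1) S + y * kd x (fun S => (ab S).2) S.
  rewrite -kdZ -kdD -[LHS]subr0 -(kd_kd x v S) -kdB; apply: eq_kd => S' S'j.
  by have [|_ ->] := abP S'; first by rewrite S'j Sj.
have -> : y * (y ^+ N * g S - kd x (fun S0 => (ab S0).2) S) =
    (y ^+ N.+1 * g S - kd x w S) + kd x (fun S => (ab S).1) S.
  by rewrite wE exprS; ring.
apply: submodD; first exact: wA.
by apply: kd_in Sj => S' /abP[].
Qed.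

End KoszulDifferential.

(** * Depth sensitivity: vanishing of the first Koszul homology *)

Section RegularSequences.
Variables (R : comPzRingType) (d : nat).
Implicit Types x y : 'I_d -> R.

Lemma koszul_exact1 x y : regular_seq y ->
  (forall i, exists n, y i ^+ n \inS ideal_gen x) ->
  forall g : {set 'I_d} -> R, kd x g finset.set0 = 0 ->
  exists w, forall S : {set 'I_d}, #|S| = 1%N -> g S = kd x w S.
Proof.
move=> [_ yreg] yx.
(* This is [prefix_ideal] with a natural number as index, so that k = d, the whole sequence, is
   included. *)
pose A k : ideal R := ideal_span [set y j | j in [set j : 'I_d | (j < k)%N]].
suff exA n k : (k + n)%N = d -> koszul_exact x (A k) k.+1.
  move=> g g0; have A0 (r : R) : r \inS A 0%N -> r = 0.
    have sub : A 0%N `<=` zeroS by apply: span_sub => u [j].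
    by move=> /sub.
  have [T|w wA] := exA d 0%N (add0n d) g.
    by move=> [/cards0_eq ->]; rewrite g0; exact: submod0.
  by exists w => S S1; apply/eqP; rewrite -subr_eq0; apply/eqP; apply: A0; exact: wA.
(* The induction descends from k = d, where no subset of the indices has d + 1 elements. *)
elim: n k => [|n IHn] k kn.
  rewrite addn0 in kn; rewrite kn => g _; exists g => S Sd.
  by have := max_card (mem S); rewrite card_ord Sd ltnn.
have kd : (k < d)%N by rewrite -kn addnS ltnS leq_addr.
pose i := Ordinal kd; have [N yN] := yx i.
apply: (koszul_exact_regular yN) (IHn k.+1 _) => [r yr|r|]; last by rewrite addSnnS.
  have /yreg/quot_pi_eq0 // : y i *: quot_pi (prefix_ideal y i) (r : R^o) = 0.
  by rewrite -linearZ; apply/quot_pi_eq0.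
split=> [|[a [b [Aa ->]]]]; last first.
  apply: submodD; last by apply: ideal_mull; apply: sub_span; exists i => /=.
  by apply: span_sub Aa => _ [j jk <-]; apply: sub_span; exists j => //=; apply: ltnW.
have adj : is_submodule (V := R^o) [set r | exists a b : R, a \inS A k /\ r = a + y i * b].
  split=> [|c _ _ [a [b [Aa ->]]] [a' [b' [Aa' ->]]]].
    by exists 0, 0; rewrite mulr0 addr0; split=> //; exact: (submod0 (A k)).
  exists (c * a + a'), (c * b + b'); split; first exact: submodZD.
  by rewrite /GRing.scale /=; ring.
apply: (@span_sub _ R^o _ (Submod adj)) => _ [j jk <-] /=.
move: jk; rewrite /= ltnS leq_eqVlt => /predU1P[jk|jk].
  exists 0, 1; rewrite add0r mulr1; split; first exact: (submod0 (A k)).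
  by congr y; exact: val_inj.
by exists (y j), 0; rewrite mulr0 addr0; split=> //; apply: sub_span; exists j.
Qed.

End RegularSequences.

(** * Length of a finite power of a module *)

Section FiniteFunctions.
Variables (R : comPzRingType) (I : finType) (W : lmodType R).
Hypothesis finW : finite_length_in [set 0 : W] setT.

Lemma supported_is_submodule (s : seq I) :
  is_submodule [set z : {ffun I -> W} | forall i, i \notin s -> z i = 0].
Proof.
split=> [i _|a u v u0 v0 i si]; first by rewrite ffunE.
by rewrite !ffunE u0 // v0 // scaler0 addr0.
Qed.

Let supp s := Submod (supported_is_submodule s).

Definition ffun_eval (i : I) (z : {ffun I -> W}) : W := z i.

Fact ffun_eval_linear i : linear (ffun_eval i).
Proof. by move=> a u v; rewrite /ffun_eval !ffunE. Qed.

HB.instance Definition _ i :=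
  GRing.isLinear.Build R {ffun I -> W} W *:%R (ffun_eval i) (ffun_eval_linear i).

(** Allowing one more index i in the support adds one copy of [W]: evaluation at i is onto [W], with
    the functions supported on the old list as kernel. *)
Lemma length_in_supp s : uniq s ->
  finite_length_in [set 0 : {ffun I -> W}] (supp s) /\
  length_in [set 0 : {ffun I -> W}] (supp s) = (size s * length_in [set 0%R : W] setT)%N.
Proof.
have supp0 : supp [::] = [set 0] :> set {ffun I -> W}.
  apply/seteqP; split=> [z z0|_ -> i _]; last by rewrite ffunE.
  by apply/ffunP => i; rewrite ffunE; exact: z0.
rewrite -supp0; elim: s => [_|i s IHs /andP[si us]].
  by split; [exact: finite_length_in_self|exact: length_in_self].
have [fs ls] := IHs us.
have nil_sub : supp [::] `<=` supp s by move=> z z0 j _; exact: z0.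
have sub : supp s `<=` supp (i :: s).
  by move=> z z0 j; rewrite inE negb_or => /andP[_]; exact: z0.
have ker (z : {ffun I -> W}) : z \inS supp (i :: s) -> ffun_eval i z = 0 -> z \inS supp s.
  move=> z0 zi j js; have [->//|ji] := eqVneq j i.
  by apply: z0; rewrite inE negb_or ji.
have im0 : ffun_eval i @` supp s = [set 0].
  apply/seteqP; split=> [_ [z z0 <-]|_ ->]; first exact: z0.
  by exists 0; [exact: submod0|exact: linear0].
have im1 : ffun_eval i @` supp (i :: s) = setT.
  apply/seteqP; split=> // w _; exists [ffun j => if j == i then w else 0].
    by move=> j; rewrite inE negb_or ffunE => /andP[/negbTE ->].
  by rewrite /ffun_eval ffunE eqxx.
have fi : finite_length_in (supp s) (supp (i :: s)).
  by apply/(finite_length_in_image sub ker); rewrite im0 im1.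
have fis : finite_length_in (supp [::]) (supp (i :: s)) by exact: finite_length_in_trans fi.
split=> //; rewrite (length_inD nil_sub sub fis) ls.
by rewrite -(length_in_image sub ker) im0 im1 mulSn addnC.
Qed.

Lemma length_in_ffun :
  finite_length_in [set 0 : {ffun I -> W}] setT /\
  length_in [set 0 : {ffun I -> W}] setT = (#|I| * length_in [set 0%R : W] setT)%N.
Proof.
have suppT : supp (enum I) = setT :> set {ffun I -> W}.
  by apply/seteqP; split=> // z _ i; rewrite mem_enum.
by rewrite -suppT cardE; exact/length_in_supp/enum_uniq.
Qed.

End FiniteFunctions.

(** * The Koszul complex with terms over R/a_j, and its homology *)

Section KoszulComplex.
Variables (R : comPzRingType) (d : nat) (x : 'I_d -> R) (a : nat -> ideal R).
Hypothesis xa : forall s j (r : R), r \inS a j.+1 -> x s * r \inS a j.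
Hypothesis fa : forall j, finite_length_in (a j) setT.

(** Reduction of R-valued coefficients to degree j. It is onto and turns [kdiff] into [kd], so
    homology can be computed on lifts. *)
Definition kof j (g : {ffun {set 'I_d} -> R^o}) : kterm d a j :=
  [ffun S : kbasis d j => quot_pi (a j) (g (val S))].

Fact kof_linear j : linear (@kof j).
Proof. by move=> c u v; apply/ffunP => S; rewrite !ffunE linearP. Qed.

HB.instance Definition _ j :=
  GRing.isLinear.Build R {ffun {set 'I_d} -> R^o} (kterm d a j) *:%R (@kof j)
    (@kof_linear j).

Lemma kof_eq j (g g' : {ffun {set 'I_d} -> R^o}) :
  kof j g = kof j g' <-> forall S : {set 'I_d}, #|S| = j -> g S - g' S \inS a j.
Proof.
split=> [/ffunP E S Sj|E].
  have Sj' : #|S| == j by apply/eqP.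
  by have := E (exist _ S Sj'); rewrite !ffunE => /quot_piP.
by apply/ffunP => -[S Sj]; rewrite !ffunE; apply/quot_piP/E/eqP.
Qed.

Lemma kof_surj j (z : kterm d a j) : exists g, kof j g = z.
Proof.
exists [ffun S => repr (kcoef S z)]; apply/ffunP => S; rewrite !ffunE quot_piK.
by rewrite /kcoef valK.
Qed.

Lemma kcoef_kof j g (S : {set 'I_d}) : #|S| = j -> kcoef S (kof j g) = quot_pi (a j) (g S).
Proof.
move=> Sj; rewrite /kcoef; case: insubP => [T _ <-|]; last by rewrite Sj eqxx.
by rewrite /= ffunE.
Qed.

Lemma kdiff_kof j g : kdiff x a j (kof j.+1 g) = kof j [ffun T => kd x g T].
Proof.
apply/ffunP => T; rewrite !ffunE linear_sum; apply: eq_bigr => s sT.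
rewrite [RHS]linearZ; congr (_ *: _).
rewrite kcoef_kof /quot_map /= ?quot_map_funE //; last first.
  by rewrite cardsU1 sT (eqP (valP T)).
by move=> _ [r ar <-]; exact: xa.
Qed.

Lemma kdiff_kdiff j z : kdiff x a j (kdiff x a j.+1 z) = 0.
Proof.
have [g <-] := kof_surj z; rewrite !kdiff_kof; apply/ffunP => T; rewrite !ffunE.
rewrite (@eq_kd _ _ x _ (kd x g)) => [|S _]; last by rewrite ffunE.
by rewrite kd_kd linear0.
Qed.

Lemma im_sub_kcycles j : imS (kdiff x a j) `<=` kcycles x a j.
Proof. by case: j => [//|j] _ [z _ <-]; exact: kdiff_kdiff. Qed.

Lemma length_kterm j : finite_length_in [set 0 : kterm d a j] setT /\
  length_in [set 0 : kterm d a j] setT = ('C(d, j) * length_in (a j) setT)%N.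
Proof.
have [fk ->] := @length_in_ffun R (kbasis d j) (quot (a j)) (finite_length_in_quot (fa j)).
split=> //; rewrite -length_chain length_quot card_sig; congr (_ * _)%N.
rewrite -[in RHS](card_ord d) -cardsT -cards_draws; apply: eq_card => S.
by rewrite !inE finset.subsetT.
Qed.

Lemma length_kterm_rank j :
  length_in [set 0 : kterm d a j.+1] setT =
  (length_in [set 0%R : kterm d a j.+1] (kcycles x a j.+1) +
   length_in [set 0%R : kterm d a j] (imS (kdiff x a j)))%N.
Proof.
have [ft _] := length_kterm j.+1.
rewrite (@length_inD _ _ zeroS (kcycles x a j.+1) fullS) //; last exact: zeroS_sub.
congr (_ + _)%N; rewrite -(@length_in_image _ _ _ (kdiff x a j) (kcycles x a j.+1) fullS) //.
congr length_in; apply/seteqP; split=> [_ [u u0 <-] //|_ ->].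
by exists 0; [exact: submod0|exact: linear0].
Qed.

Lemma length_kcycles j :
  length_in [set 0 : kterm d a j] (kcycles x a j) =
  (length_in [set 0%R : kterm d a j] (imS (kdiff x a j)) + length (khomology x a j))%N.
Proof.
have [ft _] := length_kterm j.
rewrite /khomology length_subquot; last exact: im_sub_kcycles.
rewrite (@length_inD _ _ zeroS (imS (kdiff x a j))) //; first exact: zeroS_sub.
  exact: im_sub_kcycles.
exact: finite_length_in_sub ft.
Qed.

(** Rank-nullity in each degree: the alternating sums truncated at degree n differ by the length of
    the boundaries in degree n, up to sign. *)
Lemma koszul_euler_char :
  \sum_(0 <= j < d.+1) (-1) ^+ j * (length (khomology x a j))%:Z =
  \sum_(0 <= j < d.+1) (-1) ^+ j * ('C(d, j) * length_in (a j) setT)%N%:Z.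
Proof.
pose b j := length_in [set 0 : kterm d a j] (imS (kdiff x a j)).
(* The term of degree d + 1 is zero, so there are no boundaries in degree d. *)
have bd : b d = 0%N.
  have [_ t0] := length_kterm d.+1; have := length_kterm_rank d.
  by rewrite t0 bin_small // /b; lia.
suff partial n : \sum_(0 <= j < n.+1) (-1) ^+ j * (length (khomology x a j))%:Z =
    \sum_(0 <= j < n.+1) (-1) ^+ j * ('C(d, j) * length_in (a j) setT)%N%:Z - (-1) ^+ n * (b n)%:Z.
  by rewrite partial bd mulr0 subr0.
elim: n => [|n IHn].
  rewrite !big_nat1 !expr0 !mul1r; have [_ t0] := length_kterm 0.
  by have := length_kcycles 0; rewrite t0 /b; lia.
rewrite big_nat_recr //= IHn [in RHS]big_nat_recr //=.
have [_ t1] := length_kterm n.+1; have := length_kterm_rank n.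
rewrite t1 (length_kcycles n.+1) -/(b n) -/(b n.+1) => ->.
rewrite !PoszD exprS; ring.
Qed.

(** The degree one chain with coefficients [c], extended by 0: the sum has one term on a singleton
    and none on other sets. *)
Definition kone (c : 'I_d -> R) : {ffun {set 'I_d} -> R^o} :=
  [ffun S : {set 'I_d} => \sum_(i | S == [set i]%SET) c i].

Lemma kd0 (g : {set 'I_d} -> R) : kd x g finset.set0 = \sum_i x i * g [set i]%SET.
Proof.
apply: eq_big => [s|s _]; first by rewrite finset.in_set0.
rewrite finset.setU0 /ksign eq_card0 ?expr0 ?mul1r // => t.
by rewrite inE /= finset.in_set0.
Qed.

Lemma kd0_kone c : kd x (kone c) finset.set0 = \sum_i c i * x i.
Proof.
rewrite kd0; apply: eq_bigr => i _; rewrite ffunE mulrC; congr (_ * _).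
rewrite (bigD1 i) //= big1 ?addr0 // => j /andP[/eqP/finset.set1_inj ->].
by rewrite eqxx.
Qed.

Lemma range_kof j : range (kof j) = setT.
Proof. by apply/seteqP; split=> // z _; have [g <-] := kof_surj z; exists g. Qed.

Lemma length_khomology0 :
  length (khomology x a 0) = length_in (addS (ideal_gen x) (a 0%N)) setT.
Proof.
rewrite /khomology length_subquot; last by [].
rewrite -(@length_in_comap _ _ _ (kof 0) _ fullS) //; last exact: range_kof.
(* After lifting along [kof 0] only the value on the empty set matters, and evaluation there carries
   the interval into R. *)
rewrite -(@length_in_image _ _ _ (ffun_eval finset.set0) _ fullS) //; last first.
  move=> g _ g0; exists 0 => //; rewrite linear0 -(linear0 (kof 0)).
  apply/esym/kof_eq => S /cards0_eq ->; rewrite ffunE subr0 [g _]g0.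
  exact: submod0.
congr length_in; last first.
  by apply/seteqP; split=> // r _; exists [ffun=> r]; rewrite //= /ffun_eval ffunE.
apply/seteqP; split=> [_ [g [z _ zg] <-]|_ /addSP[_ [v [/ideal_genP[c ->] av ->]]]].
  have [w wz] := kof_surj z; move: zg; rewrite -wz kdiff_kof => /esym/kof_eq.
  move=> /(_ _ (cards0 _)); rewrite ffunE => gw; apply/addSP.
  exists (kd x w finset.set0), (g finset.set0 - kd x w finset.set0).
  split=> //; last by rewrite addrC subrK.
  rewrite kd0; apply/ideal_genP; exists (fun i => w [set i]%SET).
  by apply: eq_bigr => i _; rewrite mulrC.
exists [ffun=> \sum_i c i * x i + v]; last by rewrite /= /ffun_eval ffunE.
exists (kof 1 (kone c)) => //; rewrite kdiff_kof; apply/esym/kof_eq => S /cards0_eq ->.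
by rewrite !ffunE kd0_kone addrC addKr.
Qed.

(** This says that H_1(x; R) = 0. *)
Hypothesis x_exact : forall g : {set 'I_d} -> R, kd x g finset.set0 = 0 ->
  exists w, forall S : {set 'I_d}, #|S| = 1%N -> g S = kd x w S.

Definition kd_at0 (g : {ffun {set 'I_d} -> R^o}) : R^o := kd x g finset.set0.

Fact kd_at0_linear : linear kd_at0.
Proof.
move=> c u v; rewrite /kd_at0.
transitivity (c * kd x u finset.set0 + kd x v finset.set0); last by [].
by rewrite -kdZ -kdD; apply: eq_kd => S _; rewrite !ffunE.
Qed.

HB.instance Definition _ :=
  GRing.isLinear.Build R {ffun {set 'I_d} -> R^o} R^o *:%R kd_at0 kd_at0_linear.

(** The map [kd_at0] on lifts sends the cycles onto the intersection of (x) with a_0 and the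
    boundaries onto (x) a_1; by [x_exact] its kernel consists of boundaries. *)
Lemma length_khomology1 : length (khomology x a 1) =
  length_in (idealM (ideal_gen x) (a 1%N)) (capS (ideal_gen x) (a 0%N)).
Proof.
have boundaryP g : kof 1 g \inS imS (kdiff x a 1) <->
    exists w, forall S : {set 'I_d}, #|S| = 1%N -> g S - kd x w S \inS a 1%N.
  split=> [[z _ zg]|[w gw]].
    have [w wz] := kof_surj z; move: zg; rewrite -wz kdiff_kof => /esym/kof_eq gw.
    by exists w => S /gw; rewrite ffunE.
  exists (kof 2 [ffun S => w S]) => //; rewrite kdiff_kof; apply/esym/kof_eq => S /gw.
  by rewrite ffunE (@eq_kd _ _ x _ w) // => S' _; rewrite ffunE.
have cycleP g : kof 1 g \inS kcycles x a 1 <-> kd x g finset.set0 \inS a 0%N.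
  rewrite /= kdiff_kof -(linear0 (kof 0)); split=> [/kof_eq/(_ _ (cards0 _))|g0].
    by rewrite !ffunE subr0.
  by apply/kof_eq => S /cards0_eq ->; rewrite !ffunE subr0.
rewrite /khomology length_subquot; last exact: im_sub_kcycles.
rewrite -(@length_in_comap _ _ _ (kof 1)); [|exact: range_kof|exact: im_sub_kcycles].
rewrite -(@length_in_image _ _ _ kd_at0); last 2 first.
- by move=> g; exact: im_sub_kcycles.
- move=> g _ /x_exact[w gw]; apply/boundaryP; exists w => S /gw ->.
  by rewrite subrr; exact: submod0.
congr length_in; apply/seteqP; split.
- move=> _ [g /boundaryP[w gw] <-]; apply/idealM_genP.
  exists (fun i => g [set i]%SET - kd x w [set i]%SET); split=> [i|].
    by apply: gw; rewrite cards1.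
  transitivity (kd x (fun S => g S - kd x w S) finset.set0).
    by rewrite kdB kd_kd subr0.
  by rewrite kd0; apply: eq_bigr => i _; rewrite mulrC.
(* With coefficients in a_1 the chain is zero modulo a_1, hence the boundary of 0. *)
- move=> _ /idealM_genP[c [ac ->]]; exists (kone c); last exact: kd0_kone.
  apply/boundaryP; exists (fun=> 0) => S _.
  rewrite [kd _ _ _]big1 ?subr0 => [|s _]; last by rewrite !mulr0.
  rewrite ffunE; apply: (big_ind (fun z => z \inS a 1%N)) => //; first exact: submod0.
  exact: submodD.
- move=> _ [g /cycleP g0 <-]; split=> //; apply/ideal_genP.
  by exists (fun i => g [set i]%SET); rewrite /= /kd_at0 kd0; apply: eq_bigr => i _; rewrite mulrC.
- move=> _ [/ideal_genP[c ->] a0]; exists (kone c); last exact: kd0_kone.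
  by apply/cycleP; rewrite kd0_kone.
Qed.

End KoszulComplex.

(** * Hilbert coefficients as binomial sums *)

Section FiniteDifferences.
Implicit Types (G F : nat -> int) (f : nat -> int).

Definition fdiff G (n : nat) : int := G n.+1 - G n.

(** Here m stands for n + d in the usual normalization. With this shift a forward difference lowers
    d by one and keeps the remaining coefficients. *)
Definition hilbert_poly (d : nat) f (m : nat) : int :=
  \sum_(0 <= k < d) (-1) ^+ k * f k * ('C(m - 1 - k, d - 1 - k))%:Z.

Definition eventually_hilbert d f G : Prop :=
  exists N : nat, forall m : nat, (N <= m)%N -> G m = hilbert_poly d f m.

Lemma iter_fdiff_sum G d n : iter d fdiff G n =
  \sum_(0 <= j < d.+1) (-1) ^+ j * ('C(d, j))%:Z * G (n + d - j)%N.
Proof.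
elim: d n => [|d IHd] n; first by rewrite big_nat1 expr0 bin0 !mul1r addn0 subn0.
rewrite iterS /fdiff !IHd [RHS]big_nat_recl // expr0 bin0 !mul1r subn0.
have -> : \sum_(0 <= j < d.+1) (-1) ^+ j * ('C(d, j))%:Z * G (n.+1 + d - j)%N =
    G (n + d.+1)%N + \sum_(0 <= j < d.+1) (-1) ^+ j.+1 * ('C(d, j.+1))%:Z * G (n + d - j)%N.
  rewrite big_nat_recl // expr0 bin0 !mul1r subn0 addSnnS; congr (_ + _).
  rewrite [in RHS]big_nat_recr //= bin_small // mulr0 mul0r addr0.
  by apply: eq_bigr => j _; rewrite addnS subSS.
rewrite -addrA -sumrB; congr (_ + _); apply: eq_bigr => j _.
by rewrite binS PoszD exprS addnS subSS; ring.
Qed.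

(** Pascal's rule lowers each binomial; the summand of index d is constant and drops out. *)
Lemma eventually_hilbert_fdiff d f G :
  eventually_hilbert d.+1 f G -> eventually_hilbert d f (fdiff G).
Proof.
move=> [N GN]; exists (N + d.+1)%N => m Nm; rewrite /fdiff !GN; [|lia..].
rewrite /hilbert_poly !big_nat_recr //= !subn1 /= subnn !bin0 opprD addrACA subrr addr0 -sumrB.
apply: eq_big_nat => k kd.
have [-> ->] : (d - k = (d.-1 - k).+1)%N /\ (m - k = (m.-1 - k).+1)%N by lia.
by rewrite binS PoszD; ring.
Qed.

Lemma eventually_hilbert_iter d k f G :
  eventually_hilbert (k + d) f G -> eventually_hilbert d f (iter k fdiff G).
Proof.
elim: k d => [//|k IHk] d; rewrite addSnnS => /IHk; rewrite iterS.
exact: eventually_hilbert_fdiff.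
Qed.

Lemma iter_fdiff_shift k F (b : int) (e : nat) n :
  iter k fdiff (fun m => - (F m.+1 - b * ('C(m, k + e))%:Z)) n =
  - (iter k fdiff F n.+1 - b * ('C(n, e))%:Z).
Proof.
elim: k e n => [//|k IHk] e n.
by rewrite !iterS /fdiff addSnnS !IHk binS PoszD; ring.
Qed.

(** Summation by parts, the difference of binom(n, i+1) being binom(n, i). *)
Lemma sum_bin_fdiff F i M :
  \sum_(0 <= n < M) ('C(n, i.+1))%:Z * fdiff F n =
  ('C(M, i.+1))%:Z * F M - \sum_(0 <= n < M) ('C(n, i))%:Z * F n.+1.
Proof.
elim: M => [|M IHM]; first by rewrite !big_geq // bin0n mul0r subr0.
by rewrite !big_nat_recr //= IHM binS PoszD /fdiff; ring.
Qed.

Lemma sum_bin i M : \sum_(0 <= n < M) ('C(n, i))%:Z = ('C(M, i.+1))%:Z.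
Proof.
elim: M => [|M IHM]; first by rewrite big_geq // bin0n.
by rewrite big_nat_recr //= IHM binS PoszD.
Qed.

(** Induction on i. For i = 0 the sum telescopes; otherwise one summation by parts reduces to a
    function with the leading term removed, whose coefficients are f_1, f_2, and so on. *)
Lemma hilbert_coeff_sum i d f G : (i < d)%N -> eventually_hilbert d f G ->
  exists M0, forall M, (M0 <= M)%N ->
    \sum_(0 <= n < M) ('C(n, i))%:Z * iter d fdiff G n =
    f i - (-1) ^+ i * iter (d - 1 - i) fdiff G i.
Proof.
elim: i d f G => [|i IHi] [//|d] f G id Gf.
  have [|N FN] := @eventually_hilbert_iter 1 d f G; first by rewrite addn1.
  exists N => M NM; rewrite subn1 subn0 expr0 mul1r.
  under eq_bigr do rewrite bin0 mul1r iterS /fdiff.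
  rewrite telescope_sumr // FN // /hilbert_poly big_nat1 expr0 mul1r.
  by rewrite subnn bin0 mulr1.
have [|N FN] := @eventually_hilbert_iter 1 d f G; first by rewrite addn1.
have {}FN M : (N <= M)%N -> iter d fdiff G M = f 0%N.
  by move=> /FN ->; rewrite /hilbert_poly big_nat1 expr0 mul1r subnn bin0 mulr1.
(* Removing the leading term and shifting by one leaves the coefficients with index moved down; the
   outer sign absorbs the change in (-1)^k. *)
pose G' m := - (G m.+1 - f 0%N * ('C(m, d))%:Z).
have [||M0 IH] := IHi d (fun k => f k.+1) G'; first by lia.
  have [N' GN'] := Gf; exists N' => m Nm; rewrite /G' GN' ?(leqW Nm) //.
  rewrite /hilbert_poly big_nat_recl // expr0 mul1r !subn1 /= !subn0 addrAC subrr add0r.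
  rewrite -sumrN; apply: eq_bigr => k _; rewrite exprS.
  have [-> ->] : (m - k.+1 = m.-1 - k)%N /\ (d - k.+1 = d.-1 - k)%N by lia.
  ring.
have G'n k n : (k <= d)%N ->
    iter k fdiff G' n = - (iter k fdiff G n.+1 - f 0%N * ('C(n, d - k))%:Z).
  by move=> kd; rewrite -iter_fdiff_shift subnKC.
exists (maxn N M0) => M; rewrite geq_max => /andP[NM /IH].
under eq_bigr do rewrite G'n // subnn bin0 mulr1.
rewrite G'n; last by lia.
(* The lower index is i + 1, so the removed leading term does not affect the boundary term at 0. *)
have -> : 'C(i, d - (d - 1 - i)) = 0%N by apply: bin_small; lia.
rewrite mulr0 subr0 => {}IH.
rewrite iterS sum_bin_fdiff FN //.
rewrite (_ : d.+1 - 1 - i.+1 = d - 1 - i)%N; last by lia.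
rewrite exprS mulN1r mulNr opprK -[in RHS](opprK (_ * iter _ _ _ _)) -mulrN -IH.
under [in RHS]eq_bigr do rewrite mulrN mulrBr.
rewrite sumrN sumrB -mulr_suml sum_bin; ring.
Qed.

End FiniteDifferences.

(** * Powers of an ideal and length identities for the two brackets *)

Section FiberCone.
Variable R : comPzRingType.
Implicit Types I J P Q E F : ideal R.

Lemma idealX_exp I (a : R) n : a \inS I -> a ^+ n \inS idealX I n.
Proof. by move=> Ia; elim: n => [//|n IHn]; rewrite exprS; exact: idealM_mem. Qed.

Lemma idealXz_mul I (a r : R) (z : int) :
  a \inS I -> r \inS idealXz I (z - 1) -> a * r \inS idealXz I z.
Proof.
case: z => [[|n]|n] // Ia; rewrite (_ : Posz n.+1 - 1 = n); last by lia.
exact: idealM_mem.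
Qed.

Lemma finite_lengthXz I (z : int) : noetherian R -> finite_length_in I setT ->
  finite_length_in (idealXz I z) setT.
Proof.
move=> noeth fI; case: z => n; first exact: finite_lengthX.
exact: finite_length_in_sub fI.
Qed.

(** By the modular law Q meets J + P in P + (J meet Q), so (J + Q)/(J + P) is Q modulo that sum.
    This evaluates the difference of the two h_0. *)
Lemma length_in_addS J P Q : P `<=` Q -> finite_length_in P setT ->
  length_in (addS J P) setT =
  (length_in (addS J Q) setT + length_in (addS P (capS J Q)) Q)%N.
Proof.
move=> PQ fP; have sub : addS J P `<=` addS J Q.
  by apply: addS_sub; [exact: addSl|apply: subset_trans PQ _; exact: addSr].
rewrite (@length_inD _ _ (addS J P) (addS J Q) fullS) //; last first.
  by apply: finite_length_in_sub fP => //; exact: addSr.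
rewrite addnC; congr (_ + _)%N.
have -> : addS J Q = addS Q (addS J P).
  apply/submod_eq/seteqP; split; apply: addS_sub.
  - by apply: (@subset_trans _ (addS J P)); [exact: addSl|exact: addSr].
  - exact: addSl.
  - exact: addSr.
  - exact: sub.
rewrite -length_in_capS; congr length_in; apply/seteqP; split.
  move=> _ [/[swap] /addSP[u [v [Ju Pv ->]]] Quv]; rewrite addrC; apply: submodD.
    exact: addSl.
  apply: addSr; split=> //; rewrite -(addrK v u); apply: submodB => //; exact: PQ.
apply: addS_sub => z; first by move=> Pz; split; [exact: PQ|exact: addSr].
by move=> [Jz Qz]; split=> //; exact: addSl.
Qed.

(** The length from F to the intersection of J and Q is computed through E and through the
    intersection of J and P; the quotient of the two intersections is (P + (J meet Q))/P. This is
    what turns the first bracket into the second. *)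
Lemma length_in_exchange J P Q E F : P `<=` Q -> F `<=` E -> E `<=` capS J Q ->
  F `<=` capS J P -> finite_length_in F setT ->
  (length_in (addS P (capS J Q)) Q + length_in E (capS J Q) + length_in F E =
   length_in P Q + length_in F (capS J P))%N.
Proof.
move=> PQ FE EJQ FJP fF.
have JPQ : capS J P `<=` capS J Q by move=> z [Jz /PQ].
have FP : F `<=` P by move=> z /FJP[].
have subQ : addS P (capS J Q) `<=` Q by apply: addS_sub => // z [].
have fin (M N : ideal R) : F `<=` M -> finite_length_in M N.
  by move=> FM; exact: finite_length_in_sub fF.
rewrite (@length_inD _ _ P (addS P (capS J Q)) Q) //; [|exact: addSl|exact: fin].
have -> : length_in P (addS P (capS J Q)) = length_in (capS J P) (capS J Q).
  have -> : addS P (capS J Q) = addS (capS J Q) P.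
    apply/submod_eq/seteqP.
    by split; apply: addS_sub; [exact: addSr|exact: addSl|exact: addSr|exact: addSl].
  rewrite -length_in_capS; congr length_in; apply/seteqP; split.
    by move=> z [[]].
  by move=> z [Jz Pz]; split=> //; split=> //; exact: PQ.
have /= E1 := length_inD FE EJQ (fin _ _ (@subset_refl _ F)).
have /= E2 := length_inD FJP JPQ (fin _ _ (@subset_refl _ F)).
by lia.
Qed.

End FiberCone.

(** * Assembly of the two formulas *)

Lemma fsum_nat (u : nat -> int) (i M : nat) :
  (forall n, (n < i)%N -> u n = 0) -> (forall n, (M <= n)%N -> u n = 0) ->
  finite_set [set n | (i <= n)%N /\ u n <> 0] /\
  \sum_(n \in [set n | (i <= n)%N]) u n = \sum_(0 <= n < M) u n.
Proof.
move=> ui uM; split.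
  apply: sub_finite_set (finite_II M) => n [_ un] /=.
  by rewrite ltnNge; apply/negP => /uM.
rewrite (@fsbig_widen _ _ _ _ _ setT) //; last first.
  by move=> n [_ /negP]; rewrite -ltnNge; exact: ui.
rewrite (@fsbigE _ _ _ _ _ (index_iota 0 M)) ?iota_uniq //; last first.
  by move=> n _; rewrite mem_index_iota /= -leqNgt; exact: uM.
by apply: eq_bigl => n; rewrite in_setT.
Qed.

Lemma iter_fdiff_const (F : nat -> int) (c : int) k n :
  (forall l, (n <= l <= n + k)%N -> F l = c) ->
  iter k fdiff F n = if k == 0%N then c else 0.
Proof.
elim: k n => [|k IHk] n Fc /=; first by apply: Fc; lia.
by rewrite /fdiff !IHk ?subrr // => l ln; apply: Fc; lia.
Qed.

Theorem lemma6p3 (R : comNzRingType) (m I1 I2 : ideal R) (d : nat)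
    (x : 'I_d -> R) (f : nat -> int) (i : nat)
    (R_CM : cohen_macaulay_local m)
    (dim_R : krull_dim R d)
    (d_ge1 : (1 <= d)%N)
    (residue_infinite : infinite_set [set: quot_ring m])
    (I1_primary : m_primary m I1)
    (I2_primary : m_primary m I2)
    (x_superficial : superficial_seq I2 I1 x)
    (x_reduction : minimal_reduction (ideal_gen x) I2)
    (f_coeffs : fiber_cone_coeffs I1 I2 d f)
    (i_lt_d : (i < d)%N) :
  let J := ideal_gen x in
  let K : ideal R := if (i == d - 1)%N then I1 else fullS in
  let ell M N : int := (length (@subquot R R^o M N))%:Z in
  let u (n : nat) : int := ('C(n, i))%:Z *
    (ell (idealX I2 n)
         (addS (idealM I1 (idealX I2 n)) (capS J (idealX I2 n)))
     - \sum_(1 <= j < d.+1)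
         (-1) ^+ j * (h0 I2 x j n%:Z - h1 I1 I2 x j n%:Z)) in
  let v (n : nat) : int := ('C(n, i))%:Z *
    (ell (idealX I2 n) (idealM I1 (idealX I2 n))
     - ell (idealM J (idealXz I2 (n%:Z - 1)))
           (idealM (idealM J I1) (idealXz I2 (n%:Z - 1)))
     - \sum_(2 <= j < d.+1)
         (-1) ^+ j * (h0 I2 x j n%:Z - h1 I1 I2 x j n%:Z)) in
  (* both sums over n >= i have finitely many nonzero terms *)
  [/\ finite_set [set n | (i <= n)%N /\ u n <> 0],
      f i = \sum_(n \in [set n | (i <= n)%N]) u n
            - (-1) ^+ d * (length (quot K))%:Z,
      finite_set [set n | (i <= n)%N /\ v n <> 0] &
      f i = \sum_(n \in [set n | (i <= n)%N]) v n
            - (-1) ^+ d * (length (quot K))%:Z].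
Proof.
have [noeth [mmax _] [k dim_k [[y [ym yreg]] _]]] := R_CM.
(* Depth equals dimension, so the regular sequence [y] in [m] has exactly d terms. *)
have kd := is_maximum_inj dim_k dim_R; subst k.
have [[J_sub [r redJ]] _] := x_reduction.
have mI1 : m `<=` radical I1 by rewrite I1_primary.2.
have mI2 : m `<=` radical I2 by rewrite I2_primary.2.
have fI1 := finite_length_primary noeth mmax mI1.
have fI2 := finite_length_primary noeth mmax mI2.
move=> J K ell u v.
(* The reduction puts a power of [I2] inside [J]. Hence [J] has finite colength and contains a power
   of each y_i. *)
have IJ : idealX I2 r.+1 `<=` J by rewrite -redJ; exact: idealM_subl.
have fJ : finite_length_in J setT.
  by apply: finite_length_in_sub (finite_lengthX r.+1 noeth fI2).
have x_exact : forall g : {set 'I_d} -> R, kd x g finset.set0 = 0 ->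
    exists w, forall S : {set 'I_d}, #|S| = 1%N -> g S = kd x w S.
  apply: koszul_exact1 yreg _ => i0; have [N yN] := mI2 _ (ym i0).
  by exists (N * r.+1)%N; apply: IJ; rewrite exprM; exact: idealX_exp.
have xI2 s : x s \inS I2 by apply: J_sub; apply: sub_span; exists s.
pose a0 (n : int) (k : nat) : ideal R := idealXz I2 (n - k%:Z).
pose a1 (n : int) (k : nat) : ideal R := idealM I1 (a0 n k).
have xa0 n s j (t : R) : t \inS a0 n j.+1 -> x s * t \inS a0 n j.
  move=> at_; apply: idealXz_mul => //; move: at_; rewrite /a0.
  by rewrite (_ : n - j.+1%:Z = n - j%:Z - 1) //; lia.
have xa1 n s j (t : R) : t \inS a1 n j.+1 -> x s * t \inS a1 n j.
  suff sub : a1 n j.+1 `<=` comapS (mul_by (x s)) (a1 n j) by exact: sub.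
  apply: idealM_sub => b c Ib ac; change (x s * (b * c) \inS a1 n j).
  by rewrite mulrCA; apply: idealM_mem => //; exact: xa0.
have fa0 n j : finite_length_in (a0 n j) setT by exact: finite_lengthXz.
have fa1 n j : finite_length_in (a1 n j) setT by exact: finite_length_mul.
have a1a0 n j : a1 n j `<=` a0 n j by exact: idealM_subr.
pose H (z : int) : int := (length_in (idealM I1 (idealXz I2 z)) (idealXz I2 z))%:Z.
(* The common value of both brackets: the d-th backward difference of [H] at n. *)
pose w (n : nat) : int := \sum_(0 <= j < d.+1) (-1) ^+ j * ('C(d, j))%:Z * H (n%:Z - j%:Z).
have euler (n : nat) : \sum_(0 <= j < d.+1)
    (-1) ^+ j * (h0 I2 x j n%:Z - h1 I1 I2 x j n%:Z) = - w n.
  under eq_bigr do rewrite mulrBr.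
  rewrite sumrB /h0 /h1 (koszul_euler_char (xa0 n%:Z) (fa0 n%:Z)).
  rewrite (koszul_euler_char (xa1 n%:Z) (fa1 n%:Z)) -sumrB -sumrN.
  apply: eq_bigr => j _; rewrite /H (@length_inD _ _ (a1 n%:Z j) (a0 n%:Z j) fullS) //.
  by rewrite !PoszM PoszD; ring.
have bracket1 (n : nat) : ell (idealX I2 n) (addS (idealM I1 (idealX I2 n)) (capS J (idealX I2 n)))
    - \sum_(1 <= j < d.+1) (-1) ^+ j * (h0 I2 x j n%:Z - h1 I1 I2 x j n%:Z) = w n.
  have a00 : a0 n%:Z 0%N = idealX I2 n by rewrite /a0 subr0.
  have := euler n; rewrite big_nat_recl // expr0 mul1r big_add1 /=.
  rewrite /h0 /h1 (length_khomology0 (xa0 n%:Z)) (length_khomology0 (xa1 n%:Z)).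
  rewrite -/J (@length_in_addS _ J (a1 n%:Z 0%N) (a0 n%:Z 0%N)) //.
  rewrite /ell length_subquot; last first.
    by apply: addS_sub; [exact: idealM_subr|move=> z []].
  rewrite /a1 a00 PoszD.
  have arith (b c t W : int) : b - (b + c) + t = - W -> c - t = W by lia.
  exact: arith.
have bracket2 (n : nat) : ell (idealX I2 n) (idealM I1 (idealX I2 n))
     - ell (idealM J (idealXz I2 (n%:Z - 1)))
           (idealM (idealM J I1) (idealXz I2 (n%:Z - 1)))
     - \sum_(2 <= j < d.+1) (-1) ^+ j * (h0 I2 x j n%:Z - h1 I1 I2 x j n%:Z) = w n.
  have a00 : a0 n%:Z 0%N = idealX I2 n by rewrite /a0 subr0.
  rewrite -bracket1 [in RHS]big_ltn // expr1 mulN1r.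
  rewrite /h0 /h1 (length_khomology1 (xa0 n%:Z)) // (length_khomology1 (xa1 n%:Z)) //.
  rewrite -/J; set E0 := idealM J (a0 n%:Z 1%N); set E1 := idealM J (a1 n%:Z 1%N).
  have E1E : idealM (idealM J I1) (idealXz I2 (n%:Z - 1)) = E1 by rewrite idealMA.
  have E10 : E1 `<=` E0 by apply: idealM_subS.
  have Ecap (b : nat -> ideal R) : (forall s j (t : R), t \inS b j.+1 -> x s * t \inS b j) ->
      idealM J (b 1%N) `<=` capS J (b 0%N).
    move=> xb _ /idealM_genP[c [bc ->]]; apply: (big_ind (fun z => z \inS capS J (b 0%N))).
    - exact: submod0.
    - exact: submodD.
    move=> s _; rewrite mulrC; split; last exact: xb.
    by apply: ideal_mull; apply: sub_span; exists s.
  (* Applied with P = I1 I2^n, Q = I2^n, E = J I2^(n-1) and F = J I1 I2^(n-1). *)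
  have := length_in_exchange (a1a0 n%:Z 0%N) E10 (Ecap _ (xa0 n%:Z)) (Ecap _ (xa1 n%:Z))
    (finite_length_mul noeth fJ (fa1 n%:Z 1%N)).
  have sub1 : idealM I1 (idealX I2 n) `<=` idealX I2 n by exact: idealM_subr.
  have sub2 : addS (idealM I1 (idealX I2 n)) (capS J (idealX I2 n)) `<=` idealX I2 n.
    by apply: addS_sub => // z [].
  rewrite /ell E1E !length_subquot // /a1 a00.
  have arith (b c e g h : nat) (W : int) : (b + c + e = g + h)%N ->
      g%:Z - e%:Z - W = b%:Z - (- (c%:Z - h%:Z) + W) by lia.
  exact: arith.
have uE n : u n = ('C(n, i))%:Z * w n by rewrite /u bracket1.
have vE n : v n = ('C(n, i))%:Z * w n by rewrite /v bracket2.
(* The shift by d turns backward differences of [H] into forward differences of a function on the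
   natural numbers. *)
pose G (t : nat) : int := H (t%:Z - d%:Z).
have wG n : w n = iter d fdiff G n.
  rewrite iter_fdiff_sum /w; apply: eq_big_nat => j jd; rewrite /G.
  by congr (_ * H _); lia.
have G_hilbert : eventually_hilbert d f G.
  have [N fN] := f_coeffs; exists (N + d)%N => t Nt.
  have td : t%:Z - d%:Z = (t - d)%N by lia.
  have sub : idealM I1 (idealX I2 (t - d)) `<=` idealX I2 (t - d) by exact: idealM_subr.
  have Ntd : (N <= t - d)%N by lia.
  rewrite /G /H td; have := fN _ Ntd; rewrite length_subquot // => ->.
  rewrite /hilbert_poly big_mkord; apply: eq_bigr => j _.
  by congr (_ * Posz 'C(_, _)); have := ltn_ord j; lia.
have [N wN] : exists N, forall n, (N <= n)%N -> w n = 0.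
  have [|N GN] := @eventually_hilbert_iter 0 d f G; first by rewrite addn0.
  by exists N => n /GN; rewrite wG => ->; rewrite /hilbert_poly big_geq.
have [M0 sumM] := hilbert_coeff_sum i_lt_d G_hilbert.
have main (t : nat -> int) : (forall n, t n = ('C(n, i))%:Z * w n) ->
    finite_set [set n | (i <= n)%N /\ t n <> 0] /\
    f i = \sum_(n \in [set n | (i <= n)%N]) t n - (-1) ^+ d * (length (quot K))%:Z.
  move=> tE; have [||finT ->] := @fsum_nat t i (maxn N M0).
  - by move=> n ni; rewrite tE bin_small // mul0r.
  - by move=> n; rewrite geq_max => /andP[/wN wn _]; rewrite tE wn mulr0.
  split=> //; under eq_bigr do rewrite tE wG.
  rewrite sumM ?leq_maxr //.
  (* The difference of order d - 1 - i at i involves only arguments l from i to d - 1; there l - d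
     is negative and G(l) is the length of R/I1. *)
  rewrite (@iter_fdiff_const _ (length_in I1 [set: R])%:Z) => [|l ll]; last first.
    have l0 : l%:Z - d%:Z <= 0 by lia.
    have full : idealXz I2 (l%:Z - d%:Z) = fullS by case: (l%:Z - d%:Z) l0 => [[]|].
    by rewrite /G /H full idealM_full.
  (* For i = d - 1 the boundary term cancels the one with R/I1, as (-1)^(d-1) = -(-1)^d; for smaller
     i the difference vanishes and R/K_i = 0. *)
  rewrite length_quot /K; case: (eqVneq i (d - 1)%N) => [iE|iE] /=.
    rewrite iE subnn eqxx; have -> : d = (d - 1).+1 by lia.
    by rewrite subn1 /= exprS; ring.
  have -> : (d - 1 - i == 0)%N = false by lia.
  by rewrite (length_in_self fullS) !mulr0 !subr0.
have [? ?] := main u uE; have [? ?] := main v vE; by split.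
Qed.
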